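(* Let $\Lambda$ and $\Lambda_*$ be finite connected triangle-free simplicial graphs, each with at least one edge, such that the outer automorphism groups $\mathrm{Out}(A(\Lambda))$ and $\mathrm{Out}(A(\Lambda_* ))$ are finite. Then the following are equivalent: (a) $\Lambda$ and $\Lambda_*$ are isometric; (b) $RI(S(\Lambda))$ and $RI(S(\Lambda_* ))$ are semi-isomorphic; (c) $I(X(\Lambda))$ and $I(X(\Lambda_* ))$ are semi-isomorphic.
   Context: Isometry of graphs means graph isomorphism. For $\Lambda$ as in the claim, $A(\Lambda)=\langle V(\Lambda)\mid [v,w]=1\text{ if }v,w\text{ adjacent}\rangle$, $S(\Lambda)$ is the Salvetti complex (one vertex, one loop per vertex of $\Lambda$, one square torus per edge of $\Lambda$), and $X(\Lambda)$ is its universal cover, whose vertices are identified with the elements of $A(\Lambda)$. A join subgraph is a full subgraph $\Lambda_1=\Lambda_2\circ\Lambda_3$, the join of two non-empty (hence edgeless) subgraphs. Standard product subcomplexes of $S(\Lambda)$ are the subcomplexes $S(\Lambda_1)$ with $\Lambda_1$ a join subgraph; the standard product subcomplex of $X(\Lambda)$ given by $g\in A(\Lambda)$ and $\Lambda_1$ is the full subcomplex spanned by $gA(\Lambda_1)$. They are maximal product subcomplexes if $\Lambda_1$ is a maximal join subgraph. Intersection complex $I(X(\Lambda))$: vertices are the maximal product subcomplexes of $X(\Lambda)$; $k+1$ vertices span a $k$-simplex $\triangle$ iff the intersection of the corresponding subcomplexes contains a standard product subcomplex; this intersection is then itself a standard product subcomplex, spanned by some $gA(\Lambda_\triangle)$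 with $\Lambda_\triangle=\Lambda'\circ\Lambda''$, and $\triangle$ is assigned the group $gA(\Lambda_\triangle)g^{-1}=gA(\Lambda')g^{-1}\times gA(\Lambda'')g^{-1}$, a product of two free groups. Reduced intersection complex $RI(S(\Lambda))$: vertices are the maximal product subcomplexes of $S(\Lambda)$ (i.e. maximal join subgraphs of $\Lambda$); $k+1$ vertices span a $k$-simplex iff the intersection of the corresponding maximal join subgraphs contains an edge, in which case the intersection is a join subgraph $\Lambda'\circ\Lambda''$ and the simplex is assigned the group $A(\Lambda')\times A(\Lambda'')\le A(\Lambda)$. The quasi-isometric type of an assigned group is $\mathbb{Z}\times\mathbb{Z}$, $\mathbb{Z}\times\mathbb{F}$ or $\mathbb{F}\times\mathbb{F}$ ($\mathbb{F}$ non-abelian free). A chain of an $n$-simplex $\triangle^n$ is a sequence $(\triangle^n,\dots,\triangle^0)$ with $\triangle^i$ a codimension-$1$ face of $\triangle^{i+1}$. Along a chain the coordinates can be ordered so that the group of $\triangle^i$ is $A_i\times B_i$ with $A_{i+1}$, $B_{i+1}$ free factors of $A_i$, $B_i$ respectively. A semi-morphism is a combinatorial map of underlying complexes such that for every simplex and every chain of it, with assigned group sequences $(A_n\times B_n,\dots,A_0\times B_0)$ for the chain and $(A'_n\times B'_n,\dots,A'_0\times B'_0)$ for the image chain, after possibly interchanging the two coordinates of all $A_i\times B_i$ simultaneously, $A'_{i+1}=A'_i$ implies $A_{i+1}=A_i$ and $B'_{i+1}=B'_i$ implies $B_{i+1}=B_i$ for all $i$. A semi-isomorphism is a bijective semi-morphism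 whose inverse is a semi-morphism and which preserves quasi-isometric types of assigned groups; two complexes are semi-isomorphic if there is a semi-isomorphism between them. *)

(* Defs.v *)
From HB Require Import structures.
From mathcomp Require Import all_boot finmap.
From mathcomp Require Import boolp classical_sets cardinality.

Set Implicit Arguments.
Unset Strict Implicit.
Unset Printing Implicit Defensive.

Local Open Scope group_scope.
Local Open Scope classical_set_scope.

Record sgraph := SGraph {
  svertex :> finType;
  sedge : rel svertex;
  sedge_sym : symmetric sedge;
  sedge_irr : irreflexive sedge }.

Definition has_edge (L : sgraph) := exists x y : L, sedge x y.

Definition connected_graph (L : sgraph) :=
  forall x y : L, connect (@sedge L) x y.

Definition triangle_free (L : sgraph) :=
  forall x y z : L, sedge x y -> sedge y z -> ~~ sedge x z.

Definition isometric (L M : sgraph) :=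
  exists2 f : L -> M, bijective f & forall x y, sedge (f x) (f y) = sedge x y.

(** Full subgraphs are given by their vertex sets.  [joined A B]: the full
    subgraph on [A :|: B] contains the join of the full subgraphs on [A] and
    [B], with [A] and [B] non-empty.  Disjointness of [A] and [B] follows from
    irreflexivity; in a triangle-free graph [A] and [B] are edgeless. *)
Definition joined (L : sgraph) (A B : {set L}) : bool :=
  [&& A != finset.set0, B != finset.set0 &
      [forall x in A, forall y in B, sedge x y]].

Definition is_join (L : sgraph) (C : {set L}) : bool :=
  [exists A : {set L}, exists B : {set L}, joined A B && (C == A :|: B)].

Definition max_join (L : sgraph) (C : {set L}) : bool := maxset (@is_join L) C.

Section Groups.
Variable G : groupType.
Implicit Types (H K A B X : set G) (g : G).

Definition subgroup H :=
  [/\ H 1, forall x y, H x -> H y -> H (x * y) & forall x, H x -> H x^-1].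

Definition generated X : set G :=
  \bigcap_(H in [set H | subgroup H /\ X `<=` H]) H.

Definition lcoset_of g H : set G := [set g * x | x in H].

Definition conj_of g H : set G := [set g * x * g^-1 | x in H].

Definition hom_on H (M : groupType) (f : G -> M) :=
  forall x y, H x -> H y -> f (x * y) = f x * f y.

(** [H] is the internal free product of its subgroups [A] and [B] (universal
    property of the coproduct). *)
Definition free_product_of H A B :=
  [/\ subgroup A, subgroup B, A `<=` H, B `<=` H &
    forall (M : groupType) (p q : G -> M), hom_on A p -> hom_on B q ->
    (exists h : G -> M, [/\ hom_on H h, {in A, h =1 p} & {in B, h =1 q}]) /\
    (forall h k : G -> M, hom_on H h -> hom_on H k ->
       {in A, h =1 k} -> {in B, h =1 k} -> {in H, h =1 k})].

Definition free_factor A H :=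
  subgroup H /\ exists B, free_product_of H A B.

Definition free_on X H :=
  [/\ subgroup H, X `<=` H &
    forall (M : groupType) (p : G -> M),
    (exists h : G -> M, hom_on H h /\ {in X, h =1 p}) /\
    (forall h k : G -> M, hom_on H h -> hom_on H k ->
       {in X, h =1 k} -> {in H, h =1 k})].

Definition nonabelian_free H :=
  (exists X, free_on X H) /\ exists x y, [/\ H x, H y & x * y <> y * x].

Definition infinite_cyclic H :=
  exists x, H = generated [set x] /\ forall n, (0 < n)%N -> x ^+ n <> 1.

Definition automorphism (f : G -> G) :=
  bijective f /\ {morph f : x y / x * y}.

Definition inner_aut g : G -> G := fun x => g * x * g^-1.

(** The underlying set of the group Out(G): the cosets of Inn(G) in Aut(G). *)
Definition Out : set (set (G -> G)) :=
  [set [set f \o inner_aut g | g in setT] | f in automorphism].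

End Groups.

Arguments Out G : clear implicits.

(** Quasi-isometric types of a product of two free groups: Z x Z, Z x F and
    F x F, with F non-abelian free. *)
Inductive qi_type := QI_ZZ | QI_ZF | QI_FF.

Definition has_qi_type (G : groupType) (A B : set G) (t : qi_type) :=
  match t with
  | QI_ZZ => infinite_cyclic A /\ infinite_cyclic B
  | QI_ZF => (infinite_cyclic A /\ nonabelian_free B) \/
             (nonabelian_free A /\ infinite_cyclic B)
  | QI_FF => nonabelian_free A /\ nonabelian_free B
  end.

(** Words in the generators and their inverses; [(x, true)] is the generator
    [x] and [(x, false)] its inverse. *)
Definition raag_word (L : sgraph) := seq (L * bool).

Inductive raag_eqv (L : sgraph) : raag_word L -> raag_word L -> Prop :=
| raag_refl u : raag_eqv u u
| raag_sym u v : raag_eqv u v -> raag_eqv v u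
| raag_trans v u w : raag_eqv u v -> raag_eqv v w -> raag_eqv u w
| raag_cancel u x b v :
    raag_eqv (u ++ [:: (x, b); (x, ~~ b)] ++ v) (u ++ v)
| raag_comm u x y v : sedge x y ->
    raag_eqv (u ++ [:: (x, true); (y, true)] ++ v)
             (u ++ [:: (y, true); (x, true)] ++ v).

Section Raag.
Variable L : sgraph.
Implicit Types u v w : raag_word L.

Definition raag_rel : rel (raag_word L) := fun u v => `[< raag_eqv u v >].

Lemma raag_rel_refl : reflexive raag_rel.
Proof. by move=> u; apply/asboolP/raag_refl. Qed.

Lemma raag_rel_sym : symmetric raag_rel.
Proof. by move=> u v; apply/asboolP/asboolP; apply: raag_sym. Qed.

Lemma raag_rel_trans : transitive raag_rel.
Proof.
by move=> v u w /asboolP uv /asboolP vw; apply/asboolP/(raag_trans uv vw).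
Qed.

Canonical raag_equiv := EquivRel raag_rel raag_rel_refl raag_rel_sym
  raag_rel_trans.

Local Open Scope quotient_scope.

Definition raag := {eq_quot raag_equiv}.
HB.instance Definition _ := Choice.on raag.
HB.instance Definition _ := EqQuotient.on raag.

Lemma raag_piP u v : raag_eqv u v <-> \pi_raag u = \pi_raag v.
Proof. by split=> [uv|/eqmodP/asboolP //]; apply/eqmodP/asboolP. Qed.

Definition winv u : raag_word L := rev [seq (p.1, ~~ p.2) | p <- u].

Lemma raag_eqv_cat2l w u v : raag_eqv u v -> raag_eqv (w ++ u) (w ++ v).
Proof.
elim=> {u v} [u|u v _ ih|v u x _ ih1 _ ih2|u x b v|u x y v e].
- exact: raag_refl.
- exact: raag_sym.
- exact: raag_trans ih1 ih2.
- rewrite !(catA w); exact: raag_cancel.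
- rewrite !(catA w); exact: raag_comm.
Qed.

Lemma raag_eqv_cat2r w u v : raag_eqv u v -> raag_eqv (u ++ w) (v ++ w).
Proof.
elim=> {u v} [u|u v _ ih|v u x _ ih1 _ ih2|u x b v|u x y v e].
- exact: raag_refl.
- exact: raag_sym.
- exact: raag_trans ih1 ih2.
- rewrite -!catA; exact: raag_cancel.
- rewrite -!catA; exact: raag_comm.
Qed.

Lemma winvK : involutive winv.
Proof.
move=> u; rewrite /winv map_rev revK -map_comp -[RHS]map_id.
by apply: eq_map => -[x b] /=; rewrite negbK.
Qed.

Lemma winv_cat u v : winv (u ++ v) = winv v ++ winv u.
Proof. by rewrite /winv map_cat rev_cat. Qed.

Lemma raag_winvl u : raag_eqv (winv u ++ u) [::].
Proof.
elim: u => [|[x b] u ih]; first exact: raag_refl.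
rewrite -[(x, b) :: u]/([:: (x, b)] ++ u) winv_cat -catA.
apply: raag_trans ih.
by have := raag_cancel (winv u) x (~~ b) u; rewrite negbK.
Qed.

Lemma raag_winvr u : raag_eqv (u ++ winv u) [::].
Proof. by have := raag_winvl (winv u); rewrite winvK. Qed.

Lemma raag_eqv_winv u v : raag_eqv u v -> raag_eqv (winv u) (winv v).
Proof.
move=> uv; apply: (@raag_trans _ (winv u ++ (v ++ winv v))).
  rewrite -[X in raag_eqv X](cats0 (winv u)).
  exact/raag_eqv_cat2l/raag_sym/raag_winvr.
rewrite catA -[X in raag_eqv _ X]cat0s; apply: raag_eqv_cat2r.
by apply: raag_trans (raag_winvl u); apply/raag_eqv_cat2l/raag_sym.
Qed.

Definition raag_one : raag := \pi_raag [::].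
Definition raag_mul (x y : raag) : raag := \pi_raag (repr x ++ repr y).
Definition raag_inv (x : raag) : raag := \pi_raag (winv (repr x)).

Lemma raag_reprP u : raag_eqv (repr (\pi_raag u)) u.
Proof. by apply/raag_piP; rewrite reprK. Qed.

Lemma raag_mulE u v : raag_mul (\pi_raag u) (\pi_raag v) = \pi_raag (u ++ v).
Proof.
apply/raag_piP; apply: raag_trans (raag_eqv_cat2r _ (raag_reprP u)) _.
exact/raag_eqv_cat2l/raag_reprP.
Qed.

Lemma raag_invE u : raag_inv (\pi_raag u) = \pi_raag (winv u).
Proof. exact/raag_piP/raag_eqv_winv/raag_reprP. Qed.

Lemma raag_ind (P : raag -> Prop) :
  (forall u, P (\pi_raag u)) -> forall x, P x.
Proof. by move=> Pu x; rewrite -[x]reprK. Qed.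

Lemma raag_mulA : associative raag_mul.
Proof.
elim/raag_ind=> u; elim/raag_ind=> v; elim/raag_ind=> w.
by rewrite (raag_mulE v w) (raag_mulE u v) (raag_mulE u) raag_mulE catA.
Qed.

Lemma raag_mul1 : left_id raag_one raag_mul.
Proof. by elim/raag_ind=> u; rewrite (raag_mulE [::] u). Qed.

Lemma raag_mulr1 : right_id raag_one raag_mul.
Proof. by elim/raag_ind=> u; rewrite (raag_mulE u [::]) cats0. Qed.

Lemma raag_mulV : left_inverse raag_one raag_inv raag_mul.
Proof.
elim/raag_ind=> u; rewrite (raag_invE u) (raag_mulE (winv u) u).
exact/raag_piP/raag_winvl.
Qed.

Lemma raag_mulrV : right_inverse raag_one raag_inv raag_mul.
Proof.
elim/raag_ind=> u; rewrite (raag_invE u) (raag_mulE u (winv u)).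
exact/raag_piP/raag_winvr.
Qed.

HB.instance Definition _ := isGroup.Build raag raag_mulA raag_mul1 raag_mulr1
  raag_mulV raag_mulrV.

Definition raag_gen (x : L) : raag := \pi_raag [:: (x, true)].

(** The subgroup A(C) of A(L), for C a full subgraph of L. *)
Definition raag_sub (C : {set L}) : set raag :=
  generated [set raag_gen x | x in [set` C]].

(** The square complex X(L), universal cover of the Salvetti complex.  Its
    vertices are the elements of A(L), and each cell is given by the set of
    its vertices.  A subcomplex is given by the set of its cells. *)
Definition X_cell : set (set raag) := [set c |
  [\/ exists g, c = [set g],
      exists g x, c = [set g; g * raag_gen x] |
      exists g x y, sedge x y /\
        c = [set g; g * raag_gen x; g * raag_gen y;
             g * raag_gen x * raag_gen y]]].

Definition full_subcomplex (S : set raag) : set (set raag) :=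
  [set c | X_cell c /\ c `<=` S].

(** The subcomplex spanned by gA(C); it is a standard product subcomplex when
    [is_join C]. *)
Definition X_sub (g : raag) (C : {set L}) : set (set raag) :=
  full_subcomplex (lcoset_of g (raag_sub C)).

Definition std_product_subcomplex (P : set (set raag)) :=
  exists g C, is_join C /\ P = X_sub g C.

Definition max_product_subcomplex : set (set (set raag)) :=
  [set P | exists g C, max_join C /\ P = X_sub g C].

End Raag.

(** Simplices are given by their (finite, non-empty) sets of vertices.
    [gc_label s A B]: the group assigned to [s] is A x B, with its two
    coordinates taken in this order; the order is not part of the structure,
    so both [gc_label s A B] and [gc_label s B A] hold. *)
Record group_complex := GroupComplex {
  gc_group : groupType;
  gc_vertex : choiceType;
  gc_simplex : {fset gc_vertex} -> Prop;
  gc_label : {fset gc_vertex} -> set gc_group -> set gc_group -> Prop;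
  gc_nonempty : forall s, gc_simplex s -> s != fset0;
  gc_point : forall x, gc_simplex [fset x]%fset;
  gc_face : forall s t, gc_simplex t -> (s `<=` t)%fset -> s != fset0 ->
    gc_simplex s;
  gc_labelC : forall s A B, gc_label s A B -> gc_label s B A }.

(** The chain (Delta^n, ..., Delta^0) is [c n, ..., c 0]; the values [c i]
    for [i > n] are irrelevant. *)
Definition chain (K : group_complex) (n : nat)
    (c : nat -> {fset gc_vertex K}) :=
  (forall i, (i <= n)%N -> gc_simplex (c i) /\ #|` c i| = i.+1) /\
  (forall i, (i < n)%N -> (c i `<=` c i.+1)%fset).

(** [A i] x [B i] is the group of [c i], with coordinates ordered coherently
    along the chain. *)
Definition chain_groups (K : group_complex) (n : nat)
    (c : nat -> {fset gc_vertex K}) (A B : nat -> set (gc_group K)) :=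
  (forall i, (i <= n)%N -> gc_label (c i) (A i) (B i)) /\
  (forall i, (i < n)%N ->
     free_factor (A i.+1) (A i) /\ free_factor (B i.+1) (B i)).

Definition reflects_equalities (G G' : Type) (n : nat)
    (A B : nat -> set G) (A' B' : nat -> set G') :=
  forall i, (i < n)%N ->
    (A' i.+1 = A' i -> A i.+1 = A i) /\ (B' i.+1 = B' i -> B i.+1 = B i).

(** Combinatorial maps send each open simplex homeomorphically onto an open
    simplex, hence preserve dimensions. *)
Definition combinatorial_map (K K' : group_complex)
    (f : gc_vertex K -> gc_vertex K') :=
  forall s, gc_simplex s ->
    gc_simplex (f @` s)%fset /\ {in s &, injective f}.

Definition semi_morphism (K K' : group_complex)
    (f : gc_vertex K -> gc_vertex K') :=
  combinatorial_map f /\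
  forall n (c : nat -> {fset gc_vertex K}), chain n c ->
  forall A B A' B', chain_groups n c A B ->
    chain_groups n (fun i => (f @` c i)%fset) A' B' ->
    reflects_equalities n A B A' B' \/ reflects_equalities n B A A' B'.

Definition preserves_qi_types (K K' : group_complex)
    (f : gc_vertex K -> gc_vertex K') :=
  forall s, gc_simplex s -> forall A B A' B',
    gc_label s A B -> gc_label (f @` s)%fset A' B' ->
    forall t, has_qi_type A B t <-> has_qi_type A' B' t.

Definition semi_isomorphic (K K' : group_complex) :=
  exists (f : gc_vertex K -> gc_vertex K') (g : gc_vertex K' -> gc_vertex K),
    [/\ cancel f g, cancel g f, semi_morphism f, semi_morphism g &
        preserves_qi_types f].

Section IntersectionComplex.
Variable L : sgraph.

Definition I_vertex : choiceType := set_type (@max_product_subcomplex L).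

Definition I_inter (s : {fset I_vertex}) : set (set (raag L)) :=
  [set c | forall P, P \in s -> val P c].

Definition I_simplex (s : {fset I_vertex}) :=
  s != fset0 /\ exists2 P, std_product_subcomplex P & P `<=` I_inter s.

Definition I_label (s : {fset I_vertex}) (A B : set (raag L)) :=
  exists g C D, [/\ joined C D, I_inter s = X_sub g (C :|: D),
    A = conj_of g (raag_sub C) & B = conj_of g (raag_sub D)].

Lemma joinedC (C D : {set L}) : joined C D -> joined D C.
Proof.
case/and3P=> C0 D0 /forall_inP CD; apply/and3P; split=> //.
apply/forall_inP => x xD; apply/forall_inP => y yC.
by rewrite sedge_sym (forall_inP (CD y yC)).
Qed.

Lemma I_point x : I_simplex [fset x]%fset.
Proof.
split; first by apply/fset0Pn; exists x; rewrite inE.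
have /set_mem[g [C [/maxsetp mC xE]]] := valP x.
exists (val x); first by exists g, C.
by move=> c xc P; rewrite inE => /eqP ->.
Qed.

Lemma I_face (s t : {fset I_vertex}) :
  I_simplex t -> (s `<=` t)%fset -> s != fset0 -> I_simplex s.
Proof.
move=> [_ [P Pstd Pt]] /fsubsetP st s0; split=> //; exists P => //.
by move=> c /Pt ct Q /st; apply: ct.
Qed.

Lemma I_labelC (s : {fset I_vertex}) A B : I_label s A B -> I_label s B A.
Proof.
move=> [g [C [D [CD sE AE BE]]]]; exists g, D, C.
by split=> //; [exact: joinedC | rewrite finset.setUC].
Qed.

Definition intersection_complex : group_complex :=
  @GroupComplex (raag L) I_vertex I_simplex I_label
    (fun s sP => proj1 sP) I_point I_face I_labelC.

End IntersectionComplex.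

Section ReducedIntersectionComplex.
Variable L : sgraph.

(** A maximal product subcomplex S(C) of S(L) is given by the maximal join
    subgraph C. *)
Definition RI_vertex : choiceType := {C : {set L} | max_join C}.

Definition RI_inter (s : {fset RI_vertex}) : {set L} :=
  [set x | all (fun C : RI_vertex => x \in val C) s]%SET.

Definition RI_simplex (s : {fset RI_vertex}) :=
  s != fset0 /\
  exists x y, [/\ x \in RI_inter s, y \in RI_inter s & sedge x y].

Definition RI_label (s : {fset RI_vertex}) (A B : set (raag L)) :=
  exists C D : {set L}, [/\ joined C D, RI_inter s = C :|: D,
    A = raag_sub C & B = raag_sub D].

Lemma RI_interP (s : {fset RI_vertex}) x :
  reflect (forall C, C \in s -> x \in val C) (x \in RI_inter s).
Proof. by rewrite inE; apply: allP. Qed.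

Lemma RI_point x : RI_simplex [fset x]%fset.
Proof.
split; first by apply/fset0Pn; exists x; rewrite inE.
have /maxsetp/existsP[A /existsP[B /andP[/and3P[A0 B0 /forall_inP AB]]]] :=
  valP x.
move=> /eqP xE.
have [a aA] := finset.set0Pn _ A0; have [b bB] := finset.set0Pn _ B0.
exists a, b; split; last exact: (forall_inP (AB a aA)).
- by apply/RI_interP => C; rewrite inE => /eqP ->; rewrite xE inE aA.
- by apply/RI_interP => C; rewrite inE => /eqP ->; rewrite xE inE bB orbT.
Qed.

Lemma RI_face (s t : {fset RI_vertex}) :
  RI_simplex t -> (s `<=` t)%fset -> s != fset0 -> RI_simplex s.
Proof.
move=> [_ [x [y [/RI_interP xt /RI_interP yt xy]]]] /fsubsetP st s0.
split=> //; exists x, y.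
by split=> //; apply/RI_interP => C /st; [apply: xt | apply: yt].
Qed.

Lemma RI_labelC (s : {fset RI_vertex}) A B : RI_label s A B -> RI_label s B A.
Proof.
move=> [C [D [CD sE AE BE]]]; exists D, C.
by split=> //; [exact: joinedC | rewrite finset.setUC].
Qed.

Definition reduced_intersection_complex : group_complex :=
  @GroupComplex (raag L) RI_vertex RI_simplex RI_label
    (fun s sP => proj1 sP) RI_point RI_face RI_labelC.

End ReducedIntersectionComplex.

(* Main.v *)
(** The hypothesis on Out is used through two consequences: no link of a vertex
    lies in the star of another vertex (transvections have infinite order in
    Out), and no star separates the graph (partial conjugations do too).  The
    maximal joins of type Z x F are then exactly the stars of vertices, and two
    of them span a simplex of RI(S(L)) iff the vertices are adjacent, so RI(S(L))
    determines the graph.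

    In I(X(L)) the vertices of type Z x F are the cosets g A(star v), and two of
    them span a simplex iff they meet and the vertices v, w are adjacent.  Given
    a semi-isomorphism, the images of the cosets A(star v) pairwise meet:
    otherwise some wall, of type (k, t), separates two of them, and neither is
    adjacent to k A(star t); but the cosets A(star v) that are not adjacent to
    the preimage of k A(star t) are connected to one another through cosets of
    the same kind, whose images cannot cross the wall.  By the Helly property of
    cosets of standard subgroups all images share a vertex, which yields a full
    embedding of L into M; by symmetry and finiteness L and M are isomorphic.
    Walls are handled without normal forms, by counting crossings of words
    modulo 2 and shortening words by killing generators. *)
From HB Require Import structures.
From mathcomp Require Import all_boot finmap ssralg ssrint ring zify.
From mathcomp Require Import boolp classical_sets functions cardinality.
Require Import Defs.

Set Implicit Arguments.
Unset Strict Implicit.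
Unset Printing Implicit Defensive.

Local Open Scope group_scope.
Local Open Scope classical_set_scope.

(** * Words and homomorphisms *)

Section Words.
Variable L : sgraph.
Implicit Types (u v w : raag_word L) (x y : raag L) (C D : {set L}).

Definition elt w : raag L := (\pi_(raag L) w)%qT.

Lemma elt_eqv u v : raag_eqv u v <-> elt u = elt v.
Proof. exact: raag_piP. Qed.

Lemma elt_nil : elt [::] = 1.
Proof. by []. Qed.

Lemma elt_cat u v : elt (u ++ v) = elt u * elt v.
Proof. by rewrite /elt -raag_mulE. Qed.

Lemma elt_gen a : elt [:: (a, true)] = raag_gen a.
Proof. by []. Qed.

Lemma elt_genV a : elt [:: (a, false)] = (raag_gen a)^-1.
Proof. exact: esym (raag_invE [:: (a, true)]). Qed.

Lemma elt_surj x : exists w, elt w = x.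
Proof. by exists (repr x); rewrite /elt reprK. Qed.

Lemma raag_gen_comm (a b : L) :
  sedge a b -> raag_gen a * raag_gen b = raag_gen b * raag_gen a.
Proof.
move=> ab; rewrite -!elt_gen -!elt_cat; apply/elt_eqv.
exact: (raag_comm [::] [::] ab).
Qed.

Section Lift.
Variables (M : groupType) (p : L -> M).

Definition letter_val (a : L * bool) : M := if a.2 then p a.1 else (p a.1)^-1.
Definition word_val w : M := foldr (fun a m => letter_val a * m) 1 w.
Definition lift x : M := word_val (repr x).

Lemma word_val_cat u v : word_val (u ++ v) = word_val u * word_val v.
Proof. by elim: u => [|a u IH] /=; rewrite ?mul1g // IH mulgA. Qed.

Hypothesis p_comm : forall a b, sedge a b -> p a * p b = p b * p a.

Lemma lift_elt w : lift (elt w) = word_val w.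
Proof.
have: raag_eqv (repr (elt w)) w by apply: raag_reprP.
rewrite /lift; move: (repr _) => r; elim=> [//|u v _ -> //|v u t _ -> _ -> //|u a b v|u a b v ab].
  rewrite !word_val_cat /= /letter_val /=; congr (_ * _).
  by case: b; rewrite /= !mulgA ?mulgV ?mulVg !mul1g.
rewrite !word_val_cat /= /letter_val /=; congr (_ * _).
by rewrite !mulgA p_comm.
Qed.

Lemma liftM x y : lift (x * y) = lift x * lift y.
Proof.
have [u <-] := elt_surj x; have [v <-] := elt_surj y.
by rewrite -elt_cat !lift_elt word_val_cat.
Qed.

Lemma lift_gen a : lift (raag_gen a) = p a.
Proof. by rewrite -elt_gen lift_elt /= mulg1. Qed.

End Lift.

Section MulFun.
Variables (G H : groupType) (f : G -> H).
Hypothesis fM : {morph f : x y / x * y}.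

Lemma morph1 : f 1 = 1.
Proof. by apply: (@mulIg _ (f 1)); rewrite -fM !mul1g. Qed.

Lemma morphV g : f g^-1 = (f g)^-1.
Proof. by apply: (@mulIg _ (f g)); rewrite -fM !mulVg morph1. Qed.

Lemma morphX g n : f (g ^+ n) = f g ^+ n.
Proof. by elim: n => [|n IH]; rewrite ?expg0 ?morph1 // !expgS fM IH. Qed.
End MulFun.

Lemma raag_sub_subgroup C : subgroup (raag_sub C).
Proof.
split.
- by move=> H [[]].
- move=> x y Cx Cy H HH; have [[_ HM _] _] := HH.
  by apply: HM; [apply: Cx | apply: Cy].
- by move=> x Cx H HH; have [[_ _ HV] _] := HH; apply: HV; apply: Cx.
Qed.

Lemma raag_sub1 C : raag_sub C 1. Proof. by case: (raag_sub_subgroup C). Qed.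
Arguments raag_sub1 : clear implicits.
Lemma raag_subM C x y : raag_sub C x -> raag_sub C y -> raag_sub C (x * y).
Proof. by case: (raag_sub_subgroup C) => _ h _; apply: h. Qed.
Lemma raag_subV C x : raag_sub C x -> raag_sub C x^-1.
Proof. by case: (raag_sub_subgroup C) => _ _; apply. Qed.
Lemma raag_sub_gen C a : a \in C -> raag_sub C (raag_gen a).
Proof. by move=> aC H [_]; apply; exists a. Qed.

Lemma raag_subMl C x y : raag_sub C x -> raag_sub C (x * y) <-> raag_sub C y.
Proof.
move=> Cx; split=> [/(raag_subM (raag_subV Cx))|]; last exact: raag_subM.
by rewrite mulKg.
Qed.

Lemma raag_subMr C x y : raag_sub C y -> raag_sub C (x * y) <-> raag_sub C x.
Proof.
move=> Cy; split=> [Cxy|Cx]; last exact: raag_subM.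
by have := raag_subM Cxy (raag_subV Cy); rewrite mulgK.
Qed.

Lemma raag_subVE C x : raag_sub C x^-1 <-> raag_sub C x.
Proof. by split=> /raag_subV //; rewrite invgK. Qed.

Lemma raag_sub_elt C w : all (fun a => a.1 \in C) w -> raag_sub C (elt w).
Proof.
elim: w => [_|[a b] w IH /= /andP[aC /IH Cw]]; first exact: raag_sub1.
rewrite -cat1s elt_cat; apply: raag_subM => //.
by case: b; rewrite ?elt_gen ?elt_genV; try apply: raag_subV; apply: raag_sub_gen.
Qed.

Lemma raag_subP C x :
  raag_sub C x <-> exists2 w, all (fun a => a.1 \in C) w & elt w = x.
Proof.
split=> [Cx|[w wC <-]]; last exact: raag_sub_elt.
apply: (Cx [set y | exists2 w, all (fun a => a.1 \in C) w & elt w = y]).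
split; last by move=> _ [a aC <-]; exists [:: (a, true)] => //=; rewrite andbT.
split.
- by exists [::].
- move=> _ _ [u uC <-] [v vC <-]; exists (u ++ v); last exact: elt_cat.
  by rewrite all_cat uC.
- move=> _ [u uC <-]; exists (winv u); last by rewrite /elt -raag_invE.
  by rewrite /winv all_rev all_map.
Qed.

Lemma raag_sub_ind C (P : raag L -> Prop) : P 1 ->
  (forall a x, a \in C -> P x -> P (raag_gen a * x)) ->
  (forall a x, a \in C -> P x -> P ((raag_gen a)^-1 * x)) ->
  forall x, raag_sub C x -> P x.
Proof.
move=> P1 Pg PV x /raag_subP[w wC <-{x}].
elim: w wC => [_|[a b] w IH /= /andP[aC /IH Pw]] //.
rewrite -cat1s elt_cat; case: b; rewrite ?elt_gen ?elt_genV; first exact: Pg.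
exact: PV.
Qed.

Lemma raag_sub_setT x : raag_sub [set: L]%SET x.
Proof.
have [w <-] := elt_surj x; apply: raag_sub_elt.
by apply/allP => a _; rewrite finset.in_setT.
Qed.

Lemma morph_gen_eq (M : groupType) C (f h : raag L -> M) :
  hom_on (raag_sub C) f -> hom_on (raag_sub C) h ->
  (forall a, a \in C -> f (raag_gen a) = h (raag_gen a)) ->
  forall x, raag_sub C x -> f x = h x.
Proof.
move=> fM hM fh.
have hom1 k : hom_on (raag_sub C) k -> k 1 = 1 :> M.
  move=> kM; have C1 := raag_sub1 C; apply: (@mulIg _ (k 1)).
  by rewrite -kM // !mul1g.
have homV k a : a \in C -> hom_on (raag_sub C) k ->
    k (raag_gen a)^-1 = (k (raag_gen a))^-1 :> M.
  move=> /raag_sub_gen aC kM; have aVC := raag_subV aC.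
  by apply: (@mulIg _ (k (raag_gen a))); rewrite -kM // !mulVg hom1.
(* The induction carries membership in A(C) along, because [hom_on] gives multiplicativity only when
   both factors lie in the subgroup. *)
suff fhC x : raag_sub C x -> f x = h x /\ raag_sub C x by move=> x /fhC[].
move: x; apply: raag_sub_ind; first by rewrite !hom1 //; split=> //; exact: raag_sub1.
  move=> a y aC [IH Cy]; have aC' := raag_sub_gen aC.
  by split; [rewrite fM // hM // IH fh | exact: raag_subM].
move=> a y aC [IH Cy]; have aC' := raag_subV (raag_sub_gen aC).
by split; [rewrite fM // hM // IH !homV // fh | exact: raag_subM].
Qed.

Lemma morph_eq (M : groupType) (f h : raag L -> M) :
  {morph f : x y / x * y} -> {morph h : x y / x * y} ->
  (forall a, f (raag_gen a) = h (raag_gen a)) -> f =1 h.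
Proof.
move=> fM hM fh x; apply: (@morph_gen_eq _ [set: L]%SET) => //.
exact: raag_sub_setT.
Qed.

Lemma raag_sub_mono C D : C \subset D -> raag_sub C `<=` raag_sub D.
Proof.
move=> /fintype.subsetP CD x /raag_subP[w wC <-]; apply: raag_sub_elt.
by apply: sub_all wC => a /CD.
Qed.

(** The retraction of A(L) onto A(C). On words it deletes the letters outside [C], so it serves both
    to intersect standard subgroups and to shorten paths. *)
Definition kill C : raag L -> raag L :=
  lift (fun a => if a \in C then raag_gen a else 1).

Let kill_comm C a b : sedge a b ->
  (if a \in C then raag_gen a else 1) * (if b \in C then raag_gen b else 1) =
  (if b \in C then raag_gen b else 1) * (if a \in C then raag_gen a else 1).
Proof.
by move=> ab; do 2!case: ifP => _; rewrite ?mul1g ?mulg1 //; apply: raag_gen_comm.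
Qed.

Lemma killM C : {morph kill C : x y / x * y}.
Proof. by apply: liftM; apply: kill_comm. Qed.

Lemma kill_gen C a : kill C (raag_gen a) = if a \in C then raag_gen a else 1.
Proof. by rewrite /kill lift_gen //; apply: kill_comm. Qed.

Lemma kill_elt C w : kill C (elt w) = elt [seq a <- w | a.1 \in C].
Proof.
rewrite /kill lift_elt; last exact: kill_comm.
elim: w => //= -[a b] w -> /=; rewrite /letter_val /=.
case: (a \in C); last by case: b; rewrite ?invg1 mul1g.
by rewrite -[(a, b) :: _]cat1s elt_cat; case: b; rewrite ?elt_genV.
Qed.

Lemma kill_id C x : raag_sub C x -> kill C x = x.
Proof. by move=> /raag_subP[w wC <-]; rewrite kill_elt (all_filterP wC). Qed.

Lemma kill_sub C D x : raag_sub D x -> raag_sub (C :&: D)%SET (kill C x).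
Proof.
move=> /raag_subP[w wD <-]; rewrite kill_elt; apply: raag_sub_elt.
by apply/allP => a; rewrite mem_filter finset.inE => /andP[-> /(allP wD)].
Qed.

Lemma kill_subr C D x : raag_sub D x -> raag_sub D (kill C x).
Proof. by move=> /(@kill_sub C); apply: raag_sub_mono; apply: finset.subsetIr. Qed.

(** The retraction onto A(C) fixes [x], and it maps A(D) into the subgroup of the intersection. *)
Lemma raag_subI C D x :
  raag_sub C x -> raag_sub D x -> raag_sub (C :&: D)%SET x.
Proof. by move=> Cx /(@kill_sub C); rewrite kill_id. Qed.

Lemma commute_raag_sub C x : (forall a, a \in C -> commute x (raag_gen a)) ->
  forall y, raag_sub C y -> commute x y.
Proof.
move=> xC; apply: raag_sub_ind => [|a z /xC xa xz|a z /xC xa xz].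
- exact: commute1.
- exact: commuteM.
- by apply: commuteM => //; apply: commuteV.
Qed.

Lemma raag_sub_comm C D : (forall a b, a \in C -> b \in D -> sedge a b) ->
  forall x y, raag_sub C x -> raag_sub D y -> x * y = y * x.
Proof.
move=> CD x y Cx; apply: commute_raag_sub => b bD; apply/commute_sym.
apply: commute_raag_sub Cx => a aC; apply/commute_sym/raag_gen_comm.
exact: CD.
Qed.

Lemma raag_sub_join C D : (forall a b, a \in C -> b \in D -> sedge a b) ->
  forall x, raag_sub (C :|: D)%SET x ->
  exists c d, [/\ raag_sub C c, raag_sub D d & x = c * d].
Proof.
move=> CD; apply: raag_sub_ind.
- by exists 1, 1; rewrite mulg1; split=> //; apply: raag_sub1.
- move=> a y; rewrite finset.in_setU => /orP[] aC [c [d [Cc Dd ->]]].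
    exists (raag_gen a * c), d; rewrite mulgA; split=> //.
    by apply: raag_subM => //; apply: raag_sub_gen.
  have aD := raag_sub_gen aC.
  exists c, (raag_gen a * d); split=> //; first exact: raag_subM.
  by rewrite !mulgA (raag_sub_comm CD Cc aD).
- move=> a y; rewrite finset.in_setU => /orP[] aC [c [d [Cc Dd ->]]].
    exists ((raag_gen a)^-1 * c), d; rewrite mulgA; split=> //.
    by apply: raag_subM => //; apply: raag_subV; apply: raag_sub_gen.
  have aD := raag_subV (raag_sub_gen aC).
  exists c, ((raag_gen a)^-1 * d); split=> //; first exact: raag_subM.
  by rewrite !mulgA (raag_sub_comm CD Cc aD).
Qed.

End Words.

(** * The integral Heisenberg group *)

Section Heisenberg.
Local Open Scope ring_scope.
Import GRing.Theory.

(** The triple (a, b, c) stands for the upper unitriangular 3 x 3 matrix with superdiagonal a, b and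
    corner entry c. *)
Definition heis : Type := (int * int * int)%type.
HB.instance Definition _ := Choice.on heis.

Definition heis_mul (g h : heis) : heis :=
  (g.1.1 + h.1.1, g.1.2 + h.1.2, g.2 + h.2 + g.1.1 * h.1.2).
Definition heis_inv (g : heis) : heis :=
  (- g.1.1, - g.1.2, - g.2 + g.1.1 * g.1.2).
Definition heis_one : heis := (0, 0, 0).

Lemma heis_mulA : associative heis_mul.
Proof.
move=> [[a b] c] [[a' b'] c'] [[a'' b''] c'']; rewrite /heis_mul /=.
by congr (_, _, _); ring.
Qed.
Lemma heis_mul1 : left_id heis_one heis_mul.
Proof. by move=> [[a b] c]; rewrite /heis_mul /=; congr (_, _, _); ring. Qed.
Lemma heis_mulr1 : right_id heis_one heis_mul.
Proof. by move=> [[a b] c]; rewrite /heis_mul /=; congr (_, _, _); ring. Qed.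
Lemma heis_mulV : left_inverse heis_one heis_inv heis_mul.
Proof. by move=> [[a b] c]; rewrite /heis_mul /=; congr (_, _, _); ring. Qed.
Lemma heis_mulrV : right_inverse heis_one heis_inv heis_mul.
Proof. by move=> [[a b] c]; rewrite /heis_mul /=; congr (_, _, _); ring. Qed.
End Heisenberg.

HB.instance Definition _ := isGroup.Build heis heis_mulA heis_mul1 heis_mulr1
  heis_mulV heis_mulrV.

(** * Exponent sums and commutation of generators *)

Section Height.
Import GRing.Theory.
Variable L : sgraph.
Implicit Types (x y : raag L) (u v a b : L) (C D : {set L}).

Definition hx : heis := (1, 0, 0)%R.
Definition hy : heis := (0, 1, 0)%R.

Definition height_proj (g : heis) : heis := (0, g.1.2, 0)%R.

Lemma height_projM : {morph height_proj : g h / g * h}.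
Proof. by move=> g h; rewrite /mul /= /heis_mul /height_proj /=; congr (_, _, _); ring. Qed.

(** The exponent sum of [v], realised in the copy of Z formed by the triples (0, n, 0), so that it
    can be compared with other homomorphisms into [heis]. *)
Definition chi_hom v : raag L -> heis := lift (fun a => if a == v then hy else 1).
Definition chi v x : int := (chi_hom v x).1.2.

Lemma chi_homM v : {morph chi_hom v : x y / x * y}.
Proof. by apply: liftM => a b ab; do 2!case: ifP; rewrite ?mul1g ?mulg1. Qed.

Lemma chiM v x y : chi v (x * y) = (chi v x + chi v y)%R.
Proof. by rewrite /chi chi_homM. Qed.

Lemma chi1 v : chi v 1 = 0%R.
Proof. by rewrite /chi (morph1 (chi_homM v)). Qed.

Lemma chiV v x : chi v x^-1 = (- chi v x)%R.
Proof. by rewrite /chi (morphV (chi_homM v)). Qed.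

Lemma chiX v x n : chi v (x ^+ n) = (chi v x *+ n)%R.
Proof. by elim: n => [|n IH]; rewrite ?expg0 ?chi1 // expgS chiM IH mulrS. Qed.

Lemma chi_gen v a : chi v (raag_gen a) = (a == v)%:R%R.
Proof.
rewrite /chi /chi_hom lift_gen; first by case: ifP.
by move=> b c bc; do 2!case: ifP; rewrite ?mul1g ?mulg1.
Qed.

(* The generators [u] and [v] generate a free group, which maps to the
   Heisenberg group; there the centraliser of [hx] has height zero. *)
Lemma chi_commute u v x : u != v -> ~~ sedge u v ->
  commute x (raag_gen u) -> chi v x = 0%R.
Proof.
move=> uv nuv xu.
pose p a := if a == u then hx else if a == v then hy else 1.
have p_comm a b : sedge a b -> p a * p b = p b * p a.
  rewrite /p; case: (eqVneq a u) => [->|_]; case: (eqVneq b u) => [->|_] //.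
  - by case: (eqVneq b v) => [->|]; rewrite ?(negPf nuv) // mulg1 mul1g.
  - by case: (eqVneq a v) => [->|]; rewrite sedge_sym ?(negPf nuv) // mulg1 mul1g.
  - by do 2!case: ifP; rewrite ?mulg1 ?mul1g.
have pM := liftM p_comm.
have -> : chi v x = (height_proj (lift p x)).1.2.
  have -> // : height_proj (lift p x) = height_proj (chi_hom v x).
  apply: (morph_eq (f := height_proj \o lift p) (h := height_proj \o chi_hom v)).
  - by move=> y z /=; rewrite pM height_projM.
  - by move=> y z /=; rewrite chi_homM height_projM.
  - move=> a /=; rewrite lift_gen // [RHS]/height_proj -/(chi v _) chi_gen /p.
    case: (eqVneq a u) => [->|]; first by rewrite (negPf uv).
    by case: (eqVneq a v).
have := congr1 (lift p) xu; rewrite !pM lift_gen // /p eqxx.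
case: (lift p x) => [[i j] k]; rewrite /mul /= /heis_mul /= => -[_ _].
by lia.
Qed.

Lemma raag_gen_neq1 a : raag_gen a <> 1.
Proof. by move=> /(congr1 (chi a)); rewrite chi_gen eqxx chi1. Qed.

Lemma raag_sub_genE C a : raag_sub C (raag_gen a) <-> a \in C.
Proof.
split=> [/kill_id|]; last exact: raag_sub_gen.
by rewrite kill_gen; case: ifP => // _ /esym/raag_gen_neq1.
Qed.

Lemma raag_sub_le C D : raag_sub C `<=` raag_sub D -> C \subset D.
Proof.
move=> CD; apply/fintype.subsetP => a aC.
by apply/raag_sub_genE; apply: CD; apply: raag_sub_gen.
Qed.

Lemma raag_sub0 x : raag_sub finset.set0 x -> x = 1.
Proof. by move: x; apply: raag_sub_ind => // a x; rewrite finset.inE. Qed.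

Lemma raag_gen_commute a b :
  commute (raag_gen a) (raag_gen b) -> a = b \/ sedge a b.
Proof.
move=> ab; case: (eqVneq b a) => [->|nab]; first by left.
case: (boolP (sedge b a)) => [|eab]; first by rewrite sedge_sym; right.
by have := chi_commute nab eab ab; rewrite chi_gen eqxx.
Qed.

Lemma raag_sub_cyclic a : infinite_cyclic (raag_sub [set a]%SET).
Proof.
exists (raag_gen a); split.
  congr generated; apply/seteqP; split=> [_ [b /= /finset.set1P -> <-]|_ ->] //.
  by exists a => //=; apply/finset.set11.
move=> n n0 /(congr1 (chi a)); rewrite chiX chi_gen eqxx chi1.
by rewrite [LHS]natz => -[n1]; rewrite n1 in n0.
Qed.

Definition edgeless C := forall a b, a \in C -> b \in C -> ~~ sedge a b.

(** Without edges inside [C], any assignment on the generators of [C], extended by 1 to the other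
    generators, respects all commutation relations and therefore lifts. Uniqueness holds because
    these generators generate A(C). *)
Lemma raag_sub_free C : edgeless C ->
  free_on [set raag_gen a | a in [set` C]] (raag_sub C).
Proof.
move=> nC; split; first exact: raag_sub_subgroup.
  by move=> _ [a aC <-]; apply: raag_sub_gen.
move=> M p; split; last first.
  move=> h k hM kM hk x xC; move/set_mem: xC; apply: morph_gen_eq => // a aC.
  by apply: hk; apply/mem_set; exists a.
pose q a := if a \in C then p (raag_gen a) else 1.
have q_comm a b : sedge a b -> q a * q b = q b * q a.
  rewrite /q; case: ifP => aC; case: ifP => bC; rewrite ?mul1g ?mulg1 //.
  by rewrite (negPf (nC _ _ aC bC)).
exists (lift q); split; first by move=> x y _ _; apply: liftM.
by move=> x /set_mem[a aC <-]; rewrite lift_gen // /q ifT.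
Qed.

Lemma raag_sub_nonabelian_free C a b : edgeless C -> a \in C -> b \in C ->
  a != b -> nonabelian_free (raag_sub C).
Proof.
move=> nC aC bC nab; split; first by eexists; apply: raag_sub_free nC.
exists (raag_gen a), (raag_gen b); split; try exact: raag_sub_gen.
by case/raag_gen_commute => [ab|]; [rewrite ab eqxx in nab | apply/negP/nC].
Qed.

End Height.

Section CyclicGroups.
Variable G : groupType.
Implicit Types (x y : G) (H : set G).

Lemma centraliser_subgroup x : subgroup [set y | commute x y].
Proof.
split; [exact: commute1 | by move=> y z; apply: commuteM|].
by move=> y; apply: commuteV.
Qed.

Lemma infinite_cyclic_abelian H : infinite_cyclic H ->
  forall x y, H x -> H y -> commute x y.
Proof.
move=> [z [-> _]].
have cz x : generated [set z] x -> commute z x.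
  by apply; split=> [|_ ->]; [exact: centraliser_subgroup | exact: commute_refl].
move=> x y /cz zx; apply; split=> [|_ ->]; first exact: centraliser_subgroup.
exact: commute_sym.
Qed.
End CyclicGroups.

(** * Consequences of a finite outer automorphism group *)

Section Rigid.
Variable L : sgraph.
Implicit Types (x y : raag L) (u v w a b : L) (C D : {set L}).

Definition lk v : {set L} := [set a | sedge v a]%SET.
Definition star v : {set L} := (v |: lk v)%SET.

Definition undominated := forall v w, v != w ->
  exists2 a, sedge v a & a \notin star w.

Definition off (S : {set L}) : rel L :=
  [rel a b | [&& a \notin S, b \notin S & sedge a b]].

Definition star_connected := forall v a b,
  a \notin star v -> b \notin star v -> connect (off (star v)) a b.

Lemma in_star v a : (a \in star v) = (a == v) || sedge v a.
Proof. by rewrite !finset.inE. Qed.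

Lemma star_sym v a : (a \in star v) = (v \in star a).
Proof. by rewrite !in_star eq_sym sedge_sym. Qed.

Lemma star_commute v a : a \in star v -> commute (raag_gen a) (raag_gen v).
Proof.
rewrite in_star => /orP[/eqP->|va]; first exact: commute_refl.
exact/commute_sym/raag_gen_comm.
Qed.

Lemma lift_automorphism (p q : L -> raag L) :
  (forall a b, sedge a b -> p a * p b = p b * p a) ->
  (forall a b, sedge a b -> q a * q b = q b * q a) ->
  (forall a, lift p (q a) = raag_gen a) ->
  (forall a, lift q (p a) = raag_gen a) -> automorphism (lift p).
Proof.
move=> pC qC pq qp; have pM := liftM pC; have qM := liftM qC.
split=> //; exists (lift q).
- apply: (morph_eq (f := lift q \o lift p) (h := id)) => //.
    by move=> x y /=; rewrite pM qM.
  by move=> a /=; rewrite lift_gen.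
- apply: (morph_eq (f := lift p \o lift q) (h := id)) => //.
    by move=> x y /=; rewrite qM pM.
  by move=> a /=; rewrite lift_gen.
Qed.

Definition out_class (G : groupType) (f : G -> G) : set (G -> G) :=
  [set f \o inner_aut g | g in setT].

Lemma out_classP (G : groupType) (f h : G -> G) :
  {morph h : x y / (x * y : G)} ->
  out_class f = out_class h -> exists g, forall x : G, f x = h g * h x * (h g)^-1.
Proof.
move=> hM fh.
have : out_class f f.
  exists 1 => //; apply/funext => x /=.
  by rewrite /inner_aut mul1g invg1 mulg1.
rewrite fh => -[g _ <-]; exists g => x /=.
by rewrite /inner_aut !hM morphV.
Qed.

(** The second hypothesis makes the map from [n] to the class of [F n] injective, so a finite Out(G)
    would make the natural numbers finite. *)
Lemma Out_infinite (G : groupType) (F : nat -> G -> G) :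
  (forall n, automorphism (F n)) ->
  (forall m n g, (forall x : G, F m x = F n g * F n x * (F n g)^-1) -> m = n) ->
  ~ finite_set (Out G).
Proof.
move=> FA Finj fin; apply: infinite_nat.
have inj : set_inj (((out_class (G:=G)) \o F) @^-1` Out G) ((out_class (G:=G)) \o F).
  move=> m n _ _ /= E; have [g] := out_classP (proj2 (FA n)) E.
  exact: Finj.
have := finite_preimage inj fin; congr finite_set.
by apply/seteqP; split=> n // _; exists (F n).
Qed.

(** If lk v lies in star w, the transvections sending [v] to v w^n and fixing the other generators
    are automorphisms. They represent distinct outer classes: the exponent sum of [w] in the image
    of [v] is n, and conjugation does not change it. *)
Lemma finite_Out_undominated : finite_set (Out (raag L)) -> undominated.
Proof.
move=> fin v w vw; apply: contrapT => dom.
have {}dom a : sedge v a -> a \in star w.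
  by move=> va; apply/negPn/negP => naw; apply: dom; exists a.
pose p z a := if a == v then raag_gen v * z else raag_gen a.
have pC z : raag_sub [set w]%SET z ->
    forall a b, sedge a b -> p z a * p z b = p z b * p z a.
  move=> zw.
  have vz a : sedge v a -> commute (raag_gen v * z) (raag_gen a).
    move=> va; apply/commute_sym/commuteM.
      by apply/commute_sym/raag_gen_comm.
    apply: commute_raag_sub zw => b /finset.set1P ->.
    exact/star_commute/dom.
  move=> a b; rewrite /p; case: (eqVneq a v) => [->|_];
    case: (eqVneq b v) => [->|_] //; first exact: vz.
    by rewrite sedge_sym => /vz/commute_sym.
  exact: raag_gen_comm.
have pz z y : raag_sub [set w]%SET z -> raag_sub [set w]%SET y ->
    lift (p z) y = y.
  move=> zw; apply: (morph_gen_eq (h := id)) => //.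
    by move=> ? ? _ _; apply/liftM/pC.
  move=> a /finset.set1P ->; rewrite lift_gen; last exact: pC.
  by rewrite /p eq_sym (negPf vw).
have pV z a : raag_sub [set w]%SET z -> lift (p z) (p z^-1 a) = raag_gen a.
  move=> zw; rewrite {2}/p; case: (eqVneq a v) => [->|av].
    rewrite (liftM (pC z zw)) (pz z z^-1) //; last exact: raag_subV.
    by rewrite lift_gen; [rewrite /p eqxx mulgK | exact: pC].
  by rewrite lift_gen; [rewrite /p (negPf av) | exact: pC].
have wn n : raag_sub [set w]%SET (raag_gen w ^+ n).
  elim: n => [|n IH]; first by rewrite expg0; apply: raag_sub1.
  by rewrite expgS; apply: raag_subM => //; apply: raag_sub_gen; rewrite finset.inE.
apply: (Out_infinite (F := fun n => lift (p (raag_gen w ^+ n)))) fin.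
  move=> n; have wVn := raag_subV (wn n).
  apply: (@lift_automorphism _ (p (raag_gen w ^+ n)^-1)).
  - exact: pC.
  - exact: pC.
  - by move=> a; apply: pV.
  - by move=> a; rewrite -{2}[raag_gen w ^+ n]invgK; apply: pV.
move=> m n g /(_ (raag_gen v))/(congr1 (chi w)).
rewrite !chiM !chiV !lift_gen; try exact: pC.
rewrite /p eqxx !chiM !chiX !chi_gen eqxx (negPf vw).
by lia.
Qed.

(** If star v separates [x] from [y], let [C] be the component of [x] in the complement of star v.
    Conjugating the generators in [C] by powers of [v], and fixing the others, gives infinitely many
    outer classes. *)
Lemma finite_Out_star_connected : finite_set (Out (raag L)) -> star_connected.
Proof.
move=> fin v x y xv yv; apply/negPn/negP => nxy; move: fin.
pose C := [set a | connect (off (star v)) x a]%SET.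
pose p z a := if a \in C then z * raag_gen a * z^-1 else raag_gen a.
have Cstar a : a \in C -> a \notin star v.
  rewrite finset.inE => /connectP[s + ->].
  elim/last_ind: s => //= s b _; rewrite rcons_path last_rcons.
  by case/andP=> _ /and3P[].
have CE a b : a \in C -> sedge a b -> b \notin C -> b \in star v.
  move=> aC ab; apply: contraR => bv; move: (aC); rewrite !finset.inE.
  move=> /connect_trans; apply; apply: connect1.
  by rewrite /off /= Cstar // bv.
have conjE (z g h : raag L) : commute g h -> commute (z * g * z^-1) (z * h * z^-1).
  by move=> gh; rewrite /commute !mulgA !mulgVK -!(mulgA z) gh.
have pC z : raag_sub [set v]%SET z ->
    forall a b, sedge a b -> p z a * p z b = p z b * p z a.
  move=> zv.
  (* An edge leaving [C] ends in star v. Its outer generator commutes with [z], so conjugating it by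
     [z] changes nothing, and the required relation is a conjugate of the original one. *)
  have zC a b : a \in C -> sedge a b -> b \notin C ->
      commute (z * raag_gen a * z^-1) (raag_gen b).
    move=> aC ab bC; rewrite -[raag_gen b](mulgK z).
    have -> : raag_gen b * z = z * raag_gen b.
      apply: commute_raag_sub zv => c /finset.set1P ->.
      exact/star_commute/(CE a).
    exact/conjE/raag_gen_comm.
  move=> a b ab; rewrite /p; case: ifP => aC; case: ifP => bC.
  - exact/conjE/raag_gen_comm.
  - by apply: zC => //; rewrite bC.
  - by apply/esym/zC; rewrite ?aC // sedge_sym.
  - exact: raag_gen_comm.
have vC : v \notin C.
  by apply: (contraL (@Cstar v)); rewrite in_star eqxx.
have pz z t : raag_sub [set v]%SET z -> raag_sub [set v]%SET t ->
    lift (p z) t = t.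
  move=> zv; apply: (morph_gen_eq (h := id)) => //.
    by move=> ? ? _ _; apply/liftM/pC.
  move=> a /finset.set1P ->; rewrite lift_gen; last exact: pC.
  by rewrite /p (negPf vC).
have pV z a : raag_sub [set v]%SET z -> lift (p z) (p z^-1 a) = raag_gen a.
  move=> zv; rewrite {2}/p; case: ifP => aC.
    rewrite !(liftM (pC z zv)) invgK (pz z z) // (pz z z^-1) //; last exact: raag_subV.
    by rewrite lift_gen; [rewrite /p aC !mulgA mulVg mul1g mulgVK | exact: pC].
  by rewrite lift_gen; [rewrite /p aC | exact: pC].
have vn n : raag_sub [set v]%SET (raag_gen v ^+ n).
  elim: n => [|n IH]; first by rewrite expg0; apply: raag_sub1.
  by rewrite expgS; apply: raag_subM => //; apply: raag_sub_gen; rewrite finset.inE.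
apply: (Out_infinite (F := fun n => lift (p (raag_gen v ^+ n)))).
  move=> n; have vVn := raag_subV (vn n).
  apply: (@lift_automorphism _ (p (raag_gen v ^+ n)^-1)).
  - exact: pC.
  - exact: pC.
  - by move=> a; apply: pV.
  - by move=> a; rewrite -{2}[raag_gen v ^+ n]invgK; apply: pV.
have notstar a : a \notin star v -> (a != v) && ~~ sedge a v.
  by rewrite in_star negb_or sedge_sym.
have commV (g h k l : raag L) : h = g * k * g^-1 -> h = l * k * l^-1 ->
    commute (g^-1 * l) k.
  move=> -> E; rewrite /commute -mulgA; apply: (mulgI g).
  rewrite mulVKg; apply: (mulIg l^-1).
  by rewrite -E !mulgA mulgK.
move=> m n g E; set b := lift (p _) g in E.
have [/andP[xv1 xv2] /andP[yv1 yv2]] := (notstar x xv, notstar y yv).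
have yC : (y \in C) = false by rewrite finset.inE (negPf nxy).
have xC : x \in C by rewrite finset.inE.
(* Both automorphisms fix the generator of [y], so [b] commutes with it, and [y] is neither equal
   nor adjacent to [v]. The same criterion applied to [x] then shows that v^(-m) b v^n has exponent
   sum zero in [v], whence m = n. *)
have bv : chi v b = 0%R.
  apply: (chi_commute yv1 yv2); have := E (raag_gen y).
  rewrite !lift_gen ?/p ?yC; try exact: pC.
  by move=> Ey; rewrite /commute {2}Ey mulgVK.
have := E (raag_gen x); rewrite !lift_gen ?/p ?xC; try exact: pC.
move=> Ex; have := chi_commute (x := (raag_gen v ^+ m)^-1 * (b * raag_gen v ^+ n)) xv1 xv2.
rewrite !chiM chiV !chiX chi_gen eqxx bv.
have cx : commute ((raag_gen v ^+ m)^-1 * (b * raag_gen v ^+ n)) (raag_gen x).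
  by apply: (commV _ _ _ _ (erefl _)); rewrite Ex invgM !mulgA.
by move=> /(_ cx); lia.
Qed.

End Rigid.

(** * Walls and cosets *)

Lemma exists_shortest (T : Type) (P : seq T -> Prop) :
  (exists w, P w) -> exists2 w, P w & forall w', P w' -> size w <= size w'.
Proof.
move=> [w0 Pw0].
have exn : exists n, `[< exists2 w, P w & size w = n >].
  by exists (size w0); apply/asboolP; exists w0.
case: (ex_minnP exn) => m /asboolP[w Pw <-] min_w; exists w => // w' Pw'.
by apply: min_w; apply/asboolP; exists w'.
Qed.

Section Geometry.
Variable L : sgraph.
Implicit Types (x y z g h k q : raag L) (b s t v w : L) (C D E : {set L}).
Implicit Types c : raag_word L.

Lemma lcosetP (G : groupType) (g x : G) (H : set G) :
  lcoset_of g H x <-> H (g^-1 * x).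
Proof.
split=> [[y Hy <-]|Hx]; first by rewrite mulKg.
by exists (g^-1 * x); rewrite // mulVKg.
Qed.

(* The vertices [(g, v)] stand for the cosets [g A(star v)], that is, for the
   conjugates of generators, and [near] for "commuting or equal". *)
Definition near g v h w := w \in star v /\
  exists q, raag_sub (star v) (g^-1 * q) /\ raag_sub (star w) (h^-1 * q).

Lemma raag_sub_div C x y z :
  raag_sub C (z^-1 * x) -> raag_sub C (z^-1 * y) -> raag_sub C (x^-1 * y).
Proof.
move=> /raag_subV zx /(raag_subM zx).
by rewrite invgM invgK !mulgA mulgK.
Qed.

Section Wall.
Variables (t : L) (K : set (raag L)).
Hypothesis K_lk : forall b x, sedge t b -> K (x * raag_gen b) <-> K x.

(** An edge labelled [t] is identified by its origin in the direction of the generator: this is [x]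
    for a letter read forwards and [x * (raag_gen t)^-1] for an inverse letter. *)
Definition crosses x (a : L * bool) : bool :=
  (a.1 == t) && `[< K (if a.2 then x else x * (raag_gen a.1)^-1) >].

(* The parity of the number of times the path from [x] labelled [c] crosses
   the wall dual to the edges [(z, z * raag_gen t)] with [K z]. *)
Fixpoint crossings x c : bool :=
  if c is a :: c' then crosses x a (+) crossings (x * elt [:: a]) c' else false.

Lemma crossings_cat x c (d : raag_word L) :
  crossings x (c ++ d) = crossings x c (+) crossings (x * elt c) d.
Proof.
elim: c x => [|a c IH] x /=; first by rewrite elt_nil mulg1.
by rewrite IH addbA -(cat1s a c) elt_cat mulgA.
Qed.

(** The parity is a homotopy invariant. A cancelling pair traverses one edge twice, and in a
    commuting square [K_lk] puts either both or none of the two opposite edges labelled [t] into the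
    wall. *)
Lemma crossings_eqv c (d : raag_word L) x : raag_eqv c d -> crossings x c = crossings x d.
Proof.
move=> cd; elim: cd x => {c d} [//|c d _ IH x|d c e _ IH1 _ IH2 x|c a b d x|c a b d ab x].
- by rewrite IH.
- by rewrite IH1 IH2.
- rewrite !crossings_cat; congr (_ (+) _); set z := x * _.
  rewrite [elt [:: (a, b); _]](elt_cat [:: (a, b)] [:: (a, ~~ b)]).
  rewrite [crossings z [:: _; _]]/= addbF /crosses.
  by case: b; rewrite /= ?elt_gen ?elt_genV ?mulgV ?mulVg mulg1 ?mulgK addbb.
- rewrite !crossings_cat; congr (_ (+) _); set z := x * _.
  rewrite [elt [:: (a, true); _]](elt_cat [:: (a, true)] [:: (b, true)]).
  rewrite [elt [:: (b, true); _]](elt_cat [:: (b, true)] [:: (a, true)]).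
  rewrite !elt_gen (raag_gen_comm ab); congr (_ (+) _).
  rewrite /= !addbF !elt_gen /crosses /=.
  case: (eqVneq a t) ab => [->|_] ab; case: (eqVneq b t) ab => [->|_] ab //=.
  + by rewrite addbF; apply: asbool_equiv_eq; rewrite K_lk.
  + by rewrite addbF; apply: asbool_equiv_eq; rewrite K_lk // sedge_sym.
Qed.

Lemma crossings_elt c d x : elt c = elt d -> crossings x c = crossings x d.
Proof. by move=> /elt_eqv; apply: crossings_eqv. Qed.

Lemma crossings_split x c : crossings x c ->
  exists c1 (a : L * bool) c2, c = c1 ++ a :: c2 /\ crosses (x * elt c1) a.
Proof.
elim: c x => //= a c IH x.
case: (boolP (crosses x a)) => [xa _|_ /IH[c1 [b [c2 [-> cb]]]]].
  by exists [::], a, c; rewrite elt_nil mulg1.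
exists (a :: c1), b, c2; split=> //.
by rewrite -cat1s elt_cat mulgA.
Qed.

End Wall.

(** The origins of the edges crossed by the hyperplane through the edge from [k] to
    [k * raag_gen t]; these edges are the parallel copies of that edge along A(lk t). *)
Definition wall k t : set (raag L) := [set z | raag_sub (lk t) (k^-1 * z)].

Lemma wall_lk k t b x : sedge t b -> wall k t (x * raag_gen b) <-> wall k t x.
Proof.
move=> tb; rewrite /wall /= mulgA; apply: raag_subMr; apply: raag_sub_gen.
by rewrite finset.inE.
Qed.

Lemma lk_star t : lk t \subset star t.
Proof. exact: finset.subsetUr. Qed.

Lemma mem_star t : t \in star t.
Proof. by rewrite in_star eqxx. Qed.

Lemma kill_lk t x : raag_sub (lk t) x -> kill (~: [set t])%SET x = x.
Proof.
move=> xt; apply: kill_id; move: xt; apply: raag_sub_mono.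
apply/fintype.subsetP => a; rewrite !finset.inE => ta.
by apply: contraTneq ta => ->; rewrite sedge_irr.
Qed.

Lemma kill_self t : kill (~: [set t])%SET (raag_gen t) = 1.
Proof. by rewrite kill_gen !finset.inE eqxx. Qed.

Lemma lk_commute t x : raag_sub (lk t) x -> commute (raag_gen t) x.
Proof.
apply: commute_raag_sub => a; rewrite finset.inE; exact: raag_gen_comm.
Qed.

(* A second crossing would close up a strip: the subpath between the crossings
   would be equal to an element of A(lk t), and deleting the letters [t] from
   it would shorten the path. *)
Lemma geodesic_crossing x t e c :
  (forall d, elt d = elt ((t, e) :: c) -> size c < size d) ->
  crossings t (wall (if e then x else x * (raag_gen t)^-1) t) x ((t, e) :: c).
Proof.
move=> geod; rewrite /= addbC [crosses _ _ _ _](_ : _ = true); last first.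
  rewrite /crosses eqxx /=; apply/asboolP; rewrite /wall /=.
  by case: e {geod}; rewrite mulVg; apply: raag_sub1.
rewrite addbT; apply/negP => /crossings_split[c1 [[t' e'] [c2 [cE]]]].
case/andP => /= /eqP t't; subst t' => /asboolP; rewrite /wall /=.
have shorten d r : elt d = kill (~: [set t])%SET (elt c1) ->
    (t, e) :: c = d ++ r -> size c1 < size d -> False.
  rewrite kill_elt => dE cE' ltd.
  have := geod ([seq a <- c1 | a.1 \in (~: [set t])%SET] ++ r).
  rewrite cE' !elt_cat dE => /(_ erefl).
  have := congr1 size cE'; rewrite /= !size_cat size_filter.
  by have := count_size (fun a => a.1 \in (~: [set t])%SET) c1; lia.
(* The prefix to be replaced depends on the signs. If [e] and [e'] agree, the prefix ending before
   the second crossing lies in A(lk t); if they differ, the prefix including the second crossing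
   does. In each case it equals [c1] with its letters [t] deleted. *)
have E1 : (t, e) :: c = ((t, e) :: c1) ++ (t, e') :: c2 by rewrite cE.
have E2 : (t, e) :: c = ((t, e) :: c1 ++ [:: (t, e')]) ++ c2.
  by rewrite cE /= -catA.
have elt1 : elt ((t, e) :: c1) = elt [:: (t, e)] * elt c1.
  by rewrite -elt_cat.
have elt2 : elt ((t, e) :: c1 ++ [:: (t, e')]) =
    elt [:: (t, e)] * elt c1 * elt [:: (t, e')] by rewrite -!elt_cat.
have kE y1 y2 y : raag_sub (lk t) (y1 * y * y2) ->
    kill (~: [set t])%SET y1 = 1 -> kill (~: [set t])%SET y2 = 1 ->
    kill (~: [set t])%SET y = y1 * y * y2.
  by move=> /kill_lk <- E E'; rewrite !killM E E' mul1g mulg1.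
have kV : kill (~: [set t])%SET (raag_gen t)^-1 = 1.
  by rewrite (morphV (killM _)) kill_self invg1.
have k1 : kill (~: [set t])%SET 1 = 1 :> raag L := morph1 (killM _).
case: e e' geod cE E1 E2 elt1 elt2 shorten => -[] geod cE E1 E2 elt1 elt2 shorten;
  rewrite ?elt_gen ?elt_genV ?invgM ?invgK ?mulgA in elt1 elt2 *.
- rewrite mulVg mul1g => KT; apply: shorten E1 _ => //.
  by rewrite elt1 (kE (raag_gen t) 1) ?mulg1 // kill_self.
- rewrite mulVg mul1g => KT; apply: shorten E2 _; last by rewrite /= size_cat; lia.
  by rewrite elt2 (kE (raag_gen t) (raag_gen t)^-1) // kill_self.
- rewrite -(mulgA _ _ x) mulVg mulg1 mulgV mul1g => KT.
  apply: shorten E2 _; last by rewrite /= size_cat; lia.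
  by rewrite elt2 kill_lk // -mulgA -(lk_commute KT) mulKg.
- rewrite -(mulgA _ _ x) mulVg mulg1 mulgV mul1g => KT; apply: shorten E1 _ => //.
  rewrite elt1 -[in LHS](mulgVK (raag_gen t) (elt c1)).
  rewrite -(lk_commute KT) mulKg.
  by rewrite (kE 1 (raag_gen t)^-1) ?mul1g.
Qed.

Lemma star_decompose t x : raag_sub (star t) x ->
  exists y z, [/\ raag_sub (lk t) y, raag_sub [set t]%SET z & x = y * z].
Proof.
rewrite /star finset.setUC; apply: raag_sub_join => a b'.
by rewrite !finset.inE => ta /eqP ->; rewrite sedge_sym.
Qed.

(** Among all paths from the first coset to the second, a shortest one is nonempty, and the wall
    dual to its first edge does the job. Were the wall near the first coset, the first letter could
    be dropped; were it near the second, the letters [t] could be deleted. *)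
Lemma separation g v h w :
  (forall q, raag_sub (star v) (g^-1 * q) -> ~ raag_sub (star w) (h^-1 * q)) ->
  exists k t x c, [/\ raag_sub (star v) (g^-1 * x),
    raag_sub (star w) (h^-1 * (x * elt c)), crossings t (wall k t) x c,
    ~ near k t g v & ~ near k t h w].
Proof.
move=> disj.
pose P c := exists x, raag_sub (star v) (g^-1 * x) /\
  raag_sub (star w) (h^-1 * (x * elt c)).
have [|c [x [vx wx]] min_c] := @exists_shortest _ P.
  have [c cE] := elt_surj (g^-1 * h); exists c, g.
  by rewrite cE mulVKg !mulVg; split; apply: raag_sub1.
case: c vx wx min_c => [|[t e] c] vx wx min_c.
  by rewrite elt_nil mulg1 in wx; case: (disj x).
pose k := if e then x else x * (raag_gen t)^-1.
have kx y : raag_sub (star t) (k^-1 * y) -> raag_sub (star t) (x^-1 * y).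
  rewrite /k; case: (e) => //; rewrite invgM invgK -mulgA raag_subMl //.
  by apply: raag_sub_gen; apply: mem_star.
exists k, t, x, ((t, e) :: c); split=> //.
- by apply: geodesic_crossing => d dE; apply: min_c; exists x; rewrite dE.
- move=> [vt _]; have : P c.
    exists (x * elt [:: (t, e)]); split; last by rewrite -mulgA -(elt_cat [:: (t, e)]).
    rewrite mulgA; apply: raag_subM => //; apply: raag_sub_elt.
    by rewrite /= andbT star_sym.
  by move/min_c; rewrite ltnn.
- move=> [wt [q [/kx xq hq]]].
  have [y [z [yt zt xqE]]] := star_decompose xq.
  have zw : raag_sub (star w) z.
    move: zt; apply: raag_sub_mono; apply/fintype.subsetP => a.
    by rewrite finset.in_set1 => /eqP ->; rewrite star_sym.
  set c1 := (t, e) :: c in wx min_c.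
  have [r rw c1E] : exists2 r, raag_sub (star w) r & elt c1 = y * (z * r).
    exists (q^-1 * (x * elt c1)); first exact: raag_sub_div hq wx.
    by rewrite mulgA -xqE !mulgA mulgK mulVg mul1g.
  (* The path is y z r with [y] in A(lk t) and both [z] and [r] in A(star w). Killing [t] fixes [y]
     and keeps z r inside A(star w), so the shortened path still ends in the second coset. *)
  have : P [seq a <- c1 | a.1 \in (~: [set t])%SET].
    exists x; split=> //; rewrite -kill_elt c1E killM (kill_lk yt) !mulgA.
    rewrite raag_subMr; last by apply: kill_subr; apply: raag_subM.
    by move: wx; rewrite c1E !mulgA raag_subMr // raag_subMr.
  move/min_c; rewrite /= !finset.inE eqxx /= size_filter.
  by have := count_size (fun a => a.1 \in (~: [set t])%SET) c; lia.
Qed.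

(** The parity may be computed along a path inside the coset. A crossing on such a path puts [t] in
    star v and yields a point common to both cosets, so the two would be near. *)
Lemma uncrossed k t g v x y c : ~ near k t g v ->
  raag_sub (star v) (g^-1 * x) -> raag_sub (star v) (g^-1 * y) ->
  x * elt c = y -> crossings t (wall k t) x c = false.
Proof.
move=> nkt vx vy xy.
have /raag_subP[d dv dE] := raag_sub_div vx vy.
have -> : crossings t (wall k t) x c = crossings t (wall k t) x d.
  apply: crossings_elt; first exact: wall_lk.
  by rewrite dE -xy mulKg.
apply/negP => /crossings_split[d1 [[a e] [d2 [dE' /andP[/= /eqP at']]]]].
subst a; move: dv; rewrite dE' all_cat /= => /and3P[d1v tv _] /asboolP.
have xd1 := raag_sub_elt d1v; move: tv; rewrite star_sym => tv.
set q := if e then _ else _; rewrite /wall /= => kq.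
apply: nkt; split=> //; exists q; split; first exact: raag_sub_mono (lk_star _) _ kq.
have gxd : raag_sub (star v) (g^-1 * (x * elt d1)).
  by rewrite mulgA; apply: raag_subM.
rewrite /q; case: (e) => //; rewrite mulgA; apply: raag_subM => //.
by apply: raag_subV; apply: raag_sub_gen; rewrite star_sym.
Qed.

(** The witness is the projection of [q3] to the coset of A(C), by [kill] based at [q1]. As [q1] and
    [q3] differ by an element of A(D), it stays in q1 A(C :&: D). Basing the projection at [q2]
    gives the same point, since [q1] and [q2] differ by an element of A(C), and shows that it stays
    in the coset of A(E). *)
Lemma helly3 g C h D k E q1 q2 q3 :
  raag_sub C (g^-1 * q1) -> raag_sub D (h^-1 * q1) ->
  raag_sub C (g^-1 * q2) -> raag_sub E (k^-1 * q2) ->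
  raag_sub D (h^-1 * q3) -> raag_sub E (k^-1 * q3) ->
  exists q, raag_sub (C :&: D)%SET (q1^-1 * q) /\ raag_sub E (k^-1 * q).
Proof.
move=> C1 D1 C2 E2 D3 E3.
have c12 := raag_sub_div C1 C2; have d13 := raag_sub_div D1 D3.
have e23 := raag_sub_div E2 E3.
exists (q1 * kill C (q1^-1 * q3)); rewrite mulKg; split; first exact: kill_sub.
have <- : k^-1 * q2 * kill C (q2^-1 * q3) = k^-1 * (q1 * kill C (q1^-1 * q3)).
  have -> : q2^-1 * q3 = (q1^-1 * q2)^-1 * (q1^-1 * q3).
    by rewrite invgM invgK !mulgA mulgK.
  by rewrite killM (kill_id (raag_subV c12)) invgM invgK !mulgA mulgK.
by apply: raag_subM => //; apply: kill_subr.
Qed.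

Definition meets (p r : raag L * {set L}) := exists q,
  raag_sub p.2 (p.1^-1 * q) /\ raag_sub r.2 (r.1^-1 * q).

(** The first two cosets are merged into their intersection, again a coset of a standard subgroup;
    by [helly3] it still meets every other coset, and the list has become shorter. *)
Lemma helly (s : seq (raag L * {set L})) :
  (forall p r, p \in s -> r \in s -> meets p r) ->
  exists q, forall p, p \in s -> raag_sub p.2 (p.1^-1 * q).
Proof.
case: s => [|p s]; first by exists 1.
elim: s p => [|r s IH] p meet_s.
  by exists p.1 => r; rewrite inE => /eqP ->; rewrite mulVg; apply: raag_sub1.
have [q0 [pq0 rq0]] : meets p r by apply: meet_s; rewrite !inE eqxx ?orbT.
have [|q Hq] := IH (q0, p.2 :&: r.2)%SET.
  have step p' : p' \in s -> meets (q0, p.2 :&: r.2)%SET p'.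
    move=> sp'; have [q1 [pq1 p'q1]] : meets p p'.
      by apply: meet_s; rewrite !inE ?eqxx ?sp' ?orbT.
    have [q2 [rq2 p'q2]] : meets r p'.
      by apply: meet_s; rewrite !inE ?eqxx ?sp' ?orbT.
    exact: helly3 pq0 rq0 pq1 p'q1 rq2 p'q2.
  move=> p1 p2; rewrite !inE => /orP[/eqP->|s1] /orP[/eqP->|s2].
  - by exists q0; rewrite /= mulVg; split; apply: raag_sub1.
  - exact: step.
  - by have [q [? ?]] := step _ s1; exists q.
  - by apply: meet_s; rewrite !inE ?s1 ?s2 !orbT.
have q0q := Hq _ (mem_head _ _); rewrite /= in q0q.
have sub C D x : raag_sub (C :&: D)%SET x -> raag_sub C x /\ raag_sub D x.
  by split; [move: H | move: H]; apply: raag_sub_mono;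
     [apply: finset.subsetIl | apply: finset.subsetIr].
have [Cq Dq] := sub _ _ _ q0q.
exists q => p'; rewrite !inE => /or3P[/eqP->|/eqP->|sp'].
- by rewrite -(mulVKg q0 q) mulgA; apply: raag_subM.
- by rewrite -(mulVKg q0 q) mulgA; apply: raag_subM.
- by apply: Hq; rewrite inE sp' orbT.
Qed.

Lemma off_sub (S T : {set L}) a b :
  S \subset T -> connect (off T) a b -> connect (off S) a b.
Proof.
move=> /fintype.subsetP ST; apply: connect_sub => {}a {}b /and3P[aT bT ab].
by apply: connect1; apply/and3P; split=> //; [move: aT | move: bT];
   apply: contra; apply: ST.
Qed.

Lemma off_connect_sym (S : {set L}) : connect_sym (off S).
Proof.
by apply: sym_connect_sym => a b; rewrite /off /= sedge_sym andbCA.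
Qed.

(** The set [S] lies in lk s, and the complement of star s is connected, so it suffices to reach
    that complement while avoiding [S]. A neighbour of [s] has a neighbour outside star s; the
    vertex [s] itself first moves to a neighbour outside star v, which is not in [S]. *)
Lemma off_connected (S : {set L}) s v a b : undominated L -> star_connected L ->
  s \notin star v -> (forall a, a \in S -> sedge s a && sedge v a) ->
  a \notin S -> b \notin S -> connect (off S) a b.
Proof.
move=> undom conn sv Slk.
have Sstar : S \subset star s.
  by apply/fintype.subsetP => {}a /Slk /andP[sa _]; rewrite in_star sa orbT.
have far d : d \notin star s -> d \notin S.
  by apply: contra; move: d; apply/fintype.subsetP.
have out_lk d : sedge s d -> d \notin S ->
    exists2 d', d' \notin star s & connect (off S) d d'.
  move=> sd dS; have [|d' dd' d's] := undom d s.
    by apply: contraTneq sd => ->; rewrite sedge_irr.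
  by exists d' => //; apply: connect1; rewrite /off /= dS far.
have out d : d \notin S -> exists2 d', d' \notin star s & connect (off S) d d'.
  move=> dS; case: (boolP (d \in star s)) => [|ds]; last by exists d.
  rewrite in_star => /orP[/eqP ds|/out_lk]; last exact.
  have [|d1 sd1 d1v] := undom s v.
    by apply: contraNneq sv => ->; rewrite mem_star.
  have d1S : d1 \notin S.
    apply: contra d1v => /Slk/andP[_ vd1].
    by rewrite in_star vd1 orbT.
  have [d' d's d1d'] := out_lk _ sd1 d1S; exists d' => //.
  apply: connect_trans d1d'; apply: connect1.
  by rewrite /off /= dS d1S ds sd1.
move=> /out[a' a's aa'] /out[b' b's bb'].
apply: (connect_trans aa'); rewrite off_connect_sym.
apply: (connect_trans bb'); apply: off_sub Sstar _.
exact: conn.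
Qed.

(** If the coset g A(star v) contains 1, the removed set is star v. Otherwise a shortest word from 1
    to the coset ends in some letter [s] outside star v, and every removed vertex is adjacent to
    both [s] and [v], so that [off_connected] applies. *)
Lemma near_connected g v a b : undominated L -> star_connected L ->
  ~ near g v 1 a -> ~ near g v 1 b ->
  connect (off [set d | `[< near g v 1 d >]]%SET) a b.
Proof.
move=> undom conn na nb; set S := [set d | _]%SET.
have [aS bS] : a \notin S /\ b \notin S.
  by split; rewrite finset.inE; apply/asboolPn.
case: (pselect (raag_sub (star v) g^-1)) => [v1|v1].
  have SE : S = star v.
    apply/setP => d; rewrite finset.inE; apply/asboolP/idP => [[//]|dv].
    by split=> //; exists 1; rewrite !mulg1 invg1; split=> //; apply: raag_sub1.
  by rewrite SE in aS bS *; apply: conn.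
pose P c := raag_sub (star v) (g^-1 * elt c).
have [|c Pc min_c] := @exists_shortest _ P.
  by have [c cE] := elt_surj g; exists c; rewrite /P cE mulVg; apply: raag_sub1.
case/lastP: c Pc min_c => [|c [s e]] Pc min_c.
  by case: v1; move: Pc; rewrite /P elt_nil mulg1.
have sv : s \notin star v.
  apply/negP => sv; have : P c.
    move: Pc; rewrite /P -cats1 elt_cat mulgA raag_subMr //.
    by apply: raag_sub_elt; rewrite /= sv.
  by move/min_c; rewrite size_rcons ltnn.
apply: (off_connected (s := s) (v := v)) => // d; rewrite finset.inE => /asboolP.
move=> [dv [q [gq]]]; rewrite invg1 mul1g => qd.
(* If [s] were outside star d, killing [s] would fix both [q] and the remaining factor in A(star v).
   It would thus fix the endpoint of the word while deleting its last letter. *)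
have sd : s \in star d.
  apply/negPn/negP => nsd.
  pose r := q^-1 * elt (rcons c (s, e)).
  have rv : raag_sub (star v) r by apply: raag_sub_div gq Pc.
  have killN D x : raag_sub D x -> s \notin D -> kill (~: [set s])%SET x = x.
    move=> Dx sD; apply: kill_id; move: Dx; apply: raag_sub_mono.
    apply/fintype.subsetP => d' d'D; rewrite !finset.inE.
    by apply: contraNneq sD => <-.
  have : P [seq a <- rcons c (s, e) | a.1 \in (~: [set s])%SET].
    rewrite /P -kill_elt -[elt (rcons _ _)](mulVKg q) killM.
    by rewrite (killN _ _ qd nsd) (killN _ _ rv sv) mulVKg.
  move/min_c; rewrite filter_rcons /= !finset.inE eqxx /= size_rcons size_filter.
  by have := count_size (fun a => a.1 \in (~: [set s])%SET) c; lia.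
move: dv sd sv; rewrite !in_star negb_or => /orP[/eqP ->|vd].
  rewrite [s == v]eq_sym => /orP[/eqP ->|vs]; first by rewrite eqxx.
  by rewrite vs andbF.
case/orP=> [/eqP ->|ds]; first by rewrite vd andbF.
by move=> _; rewrite vd andbT sedge_sym.
Qed.

End Geometry.

(** * Join subgraphs *)

Section Joins.
Variable L : sgraph.
Hypothesis tri : triangle_free L.
Implicit Types (v w a b : L) (A B C D E : {set L}).

Lemma joinedP C D : reflect
  [/\ exists a, a \in C, exists b, b \in D &
      forall a b, a \in C -> b \in D -> sedge a b] (joined C D).
Proof.
apply: (iffP and3P) => [[/finset.set0Pn C0 /finset.set0Pn D0 /forall_inP CD]|].
  by split=> // a b aC; apply: (forall_inP (CD a aC)).
move=> [C0 D0 CD]; split; [exact/finset.set0Pn | exact/finset.set0Pn|].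
by apply/forall_inP => a aC; apply/forall_inP => b; apply: CD.
Qed.

Lemma is_joinP E : reflect (exists C D, joined C D /\ E = (C :|: D)%SET) (is_join E).
Proof.
apply: (iffP existsP) => [[C /existsP[D /andP[CD /eqP ->]]]|[C [D [CD ->]]]].
  by exists C, D.
by exists C; apply/existsP; exists D; rewrite CD eqxx.
Qed.

Lemma joined_edgeless C D : joined C D -> edgeless C.
Proof.
move=> /joinedP[_ [d dD] CD] a b aC bC; apply/negP => ab.
have /negP := tri ab (CD _ _ bC dD); apply; exact: CD.
Qed.

Lemma joined_disjoint C D a : joined C D -> a \in C -> a \in D -> False.
Proof. by move=> /joinedP[_ _ CD] aC aD; have := CD _ _ aC aD; rewrite sedge_irr. Qed.

(** In a triangle-free graph [C] is edgeless, so adjacency to one vertex of [C] tells the two sides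
    of the join apart. Hence the union determines the unordered pair of sides. *)
Lemma joined_lk C D a : joined C D -> a \in C ->
  D = ((C :|: D) :&: lk a)%SET /\ C = ((C :|: D) :\: lk a)%SET.
Proof.
move=> CD aC; have nC := joined_edgeless CD; have [_ _ CDE] := joinedP _ _ CD.
split; apply/setP => b; rewrite !finset.inE.
  case: (boolP (b \in D)) => [bD|bD]; first by rewrite orbT CDE.
  by rewrite orbF; case: (boolP (b \in C)) => // bC; rewrite (negPf (nC _ _ aC bC)).
case: (boolP (b \in C)) => [bC|bC]; first by rewrite (negPf (nC _ _ aC bC)).
by rewrite orFb; case: (boolP (b \in D)) => // bD; rewrite ?andbF // CDE.
Qed.

Lemma joined_unique C D C' D' : joined C D -> joined C' D' ->
  (C :|: D = C' :|: D')%SET -> (C' = C /\ D' = D) \/ (C' = D /\ D' = C).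
Proof.
move=> CD CD' E; have [[a aC] _ _] := joinedP _ _ CD.
have [DE CE] := joined_lk CD aC.
have : a \in (C' :|: D')%SET by rewrite -E finset.in_setU aC.
rewrite finset.in_setU => /orP[] aX; [left | right].
  have [D'E C'E] := joined_lk CD' aX; rewrite -E in D'E C'E.
  by split; [exact: etrans C'E (esym CE) | exact: etrans D'E (esym DE)].
have [C'E D'E] := joined_lk (joinedC CD') aX.
rewrite finset.setUC -E in C'E D'E.
by split; [exact: etrans C'E (esym DE) | exact: etrans D'E (esym CE)].
Qed.

(** An edge inside star v must have [v] as an endpoint, as otherwise it would form a triangle with
    [v]; that endpoint also lies in star w. *)
Lemma edge_in_stars v w a b : a \in star v -> b \in star v ->
  a \in star w -> b \in star w -> sedge a b -> w \in star v.
Proof.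
move=> av bv aw bw ab; have [|va] := eqVneq a v; first by move=> <-; rewrite star_sym.
have [|vb] := eqVneq b v; first by move=> <-; rewrite star_sym.
move: av bv; rewrite !in_star (negPf va) (negPf vb) /= sedge_sym => av bv.
by have := tri av bv; rewrite ab.
Qed.

Hypotheses (undom : undominated L) (edge : has_edge L).

Lemma two_neighbours v : exists a b, [/\ sedge v a, sedge v b & a != b].
Proof.
have [a va] : exists a, sedge v a.
  have [x [y xy]] := edge.
  have nxy : x != y by apply: contraTneq xy => ->; rewrite sedge_irr.
  have [vx|vx] := eqVneq v x; last by have [a va _] := undom vx; exists a.
  by exists y; rewrite vx.
have nva : v != a by apply: contraTneq va => ->; rewrite sedge_irr.
have [b vb ba] := undom nva; exists a, b; split=> //.
by apply: contraNneq ba => ->; rewrite mem_star.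
Qed.

Lemma joined_star v : joined [set v]%SET (lk v).
Proof.
have [a [_ [va _ _]]] := two_neighbours v; apply/joinedP; split.
- by exists v; rewrite finset.inE.
- by exists a; rewrite finset.inE.
- by move=> x y; rewrite !finset.inE => /eqP ->.
Qed.

Lemma is_join_star v : is_join (star v).
Proof. by apply/is_joinP; exists [set v]%SET, (lk v); split=> //; exact: joined_star. Qed.

(** In a join containing star v, the side opposite to [v] is exactly lk v. Another vertex on the
    side of [v] would have all of lk v in its star, against [undominated]. *)
Lemma max_join_star v : max_join (star v).
Proof.
apply/maxsetP; split; first exact: is_join_star.
move=> E /is_joinP[C [D [CD ->]]] /fintype.subsetP vCD.
wlog vC : C D CD vCD / v \in C.
  move=> H; have := vCD v (mem_star v); rewrite finset.in_setU => /orP[vC|vD].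
    exact: H.
  rewrite finset.setUC; apply: H => //; first exact: joinedC.
  by rewrite finset.setUC.
have [DE _] := joined_lk CD vC.
have lkD : lk v = D.
  rewrite DE; apply/setP => a; rewrite finset.in_setI.
  case: (boolP (a \in lk v)) => [av|]; last by rewrite andbF.
  by rewrite vCD // finset.in_setU av orbT.
congr (_ :|: _)%SET => //; apply/setP => c; rewrite !finset.inE.
apply/idP/eqP => [cC|->//]; apply/eqP; apply: contraT; rewrite eq_sym => vc.
have [a va ac] := undom vc; have aD : a \in D by rewrite -lkD finset.inE.
have [_ _ CDE] := joinedP _ _ CD.
by rewrite in_star CDE // orbT in ac.
Qed.

Lemma star_inj : injective (@star L).
Proof.
move=> v w vw; apply/eqP; apply: contraT => nvw.
have [a va] := undom nvw; rewrite -vw.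
by rewrite in_star va orbT.
Qed.

Lemma max_join1 v E D : max_join E -> joined [set v]%SET D ->
  E = ([set v] :|: D)%SET -> E = star v.
Proof.
move=> /maxsetP[_ maxE] vD EE; apply/esym/maxE; first exact: is_join_star.
have [_ _ vDE] := joinedP _ _ vD.
rewrite EE; apply/fintype.subsetP => a; rewrite !finset.inE => /orP[->//|aD].
by rewrite vDE ?orbT // finset.inE.
Qed.

End Joins.

Section GraphEmbedding.
Implicit Types L M : sgraph.

Definition full_embedding L M (f : L -> M) :=
  injective f /\ forall x y, sedge (f x) (f y) = sedge x y.

(** Injections in both directions between finite vertex sets give equal cardinalities, so [f] is
    bijective. *)
Lemma isometric_of_embeddings L M (f : L -> M) (g : M -> L) :
  full_embedding f -> full_embedding g -> isometric L M.
Proof.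
move=> [fI fE] [gI _]; exists f => //.
by apply: inj_card_bij => //; apply: leq_card gI.
Qed.
End GraphEmbedding.

(** * Transport along isomorphisms *)

Lemma image_cancel (T U : Type) (f : T -> U) (g : U -> T) (A : set T) :
  cancel f g -> [set g x | x in [set f x | x in A]] = A.
Proof.
move=> fK; apply/seteqP; split=> [_ [_ [x Ax <-] <-]|x Ax]; first by rewrite fK.
by exists (f x); [exists x | rewrite fK].
Qed.

Section GroupIso.
Variables (G H : groupType) (f : G -> H) (f' : H -> G).
Hypotheses (fM : {morph f : x y / x * y}) (fK : cancel f f').
Implicit Types (A B X : set G).

Lemma subgroup_image A : subgroup A -> subgroup [set f x | x in A].
Proof.
move=> [A1 AM AV]; split.
- by exists 1; rewrite // morph1.
- by move=> _ _ [x Ax <-] [y Ay <-]; exists (x * y); rewrite ?fM //; apply: AM.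
- by move=> _ [x Ax <-]; exists x^-1; rewrite ?morphV //; apply: AV.
Qed.

Lemma subgroup_preimage (B : set H) : subgroup B -> subgroup (f @^-1` B).
Proof.
move=> [B1 BM BV]; split; rewrite /preimage /=.
- by rewrite morph1.
- by move=> x y Bx By; rewrite fM; apply: BM.
- by move=> x Bx; rewrite morphV //; apply: BV.
Qed.

Lemma generated_image X :
  [set f x | x in generated X] = generated [set f x | x in X].
Proof.
apply/seteqP; split=> [_ [x Xx <-] B [sB XB]|y Xy].
  apply: (Xx (f @^-1` B)); split; first exact: subgroup_preimage.
  by move=> z Xz; apply: XB; exists z.
apply: (Xy [set f x | x in generated X]); split.
  apply: subgroup_image; split.
  - by move=> B [[]].
  - move=> a b Xa Xb B HB; have [[_ BM _] _] := HB.
    by apply: BM; [apply: Xa | apply: Xb].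
  - by move=> a Xa B HB; have [[_ _ BV] _] := HB; apply: BV; apply: Xa.
by move=> _ [z Xz <-]; exists z => // B [_]; apply.
Qed.

Lemma infinite_cyclic_image A :
  infinite_cyclic A -> infinite_cyclic [set f x | x in A].
Proof.
move=> [x [-> xn]]; exists (f x); split.
  by rewrite generated_image image_set1.
move=> n /xn xn1; rewrite -morphX // => fxn; apply: xn1.
by apply: (can_inj fK); rewrite fxn morph1.
Qed.

Lemma free_on_image X A :
  free_on X A -> free_on [set f x | x in X] [set f x | x in A].
Proof.
move=> [sA XA univ]; split; first exact: subgroup_image.
  by move=> _ [x Xx <-]; exists x => //; apply: XA.
move=> M p; have [[h [hM hp]] uniq_h] := univ M (p \o f).
split.
  exists (h \o f'); split.
    by move=> _ _ [x Ax <-] [y Ay <-] /=; rewrite -fM !fK hM.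
  move=> _ /set_mem[x Xx <-] /=; rewrite fK.
  by apply: hp; apply/mem_set.
move=> k1 k2 k1M k2M k12 _ /set_mem[x Ax <-].
have [_ uniq_k] := univ M (k1 \o f).
apply: (uniq_k (k1 \o f) (k2 \o f)).
- by move=> y z Ay Az /=; rewrite fM k1M //; [exists y | exists z].
- by move=> y z Ay Az /=; rewrite fM k2M //; [exists y | exists z].
- by move=> y /set_mem Xy /=; apply: k12; apply/mem_set; exists y.
- exact/mem_set.
Qed.

Lemma nonabelian_free_image A :
  nonabelian_free A -> nonabelian_free [set f x | x in A].
Proof.
move=> [[X XA] [x [y [Ax Ay xy]]]]; split.
  by exists [set f x | x in X]; apply: free_on_image.
exists (f x), (f y); split; [by exists x | by exists y|].
by rewrite -!fM => /(can_inj fK).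
Qed.

Lemma has_qi_type_image A B t : has_qi_type A B t ->
  has_qi_type [set f x | x in A] [set f x | x in B] t.
Proof.
case: t => /=.
- by move=> [? ?]; split; apply: infinite_cyclic_image.
- by move=> [[? ?]|[? ?]]; [left | right]; split;
    first [exact: infinite_cyclic_image | exact: nonabelian_free_image].
- by move=> [? ?]; split; apply: nonabelian_free_image.
Qed.
End GroupIso.

Lemma has_qi_typeC (G : groupType) (A B : set G) t :
  has_qi_type A B t <-> has_qi_type B A t.
Proof. by case: t => /=; tauto. Qed.

Lemma has_qi_type_iso (G H : groupType) (f : G -> H) (f' : H -> G) A B t :
  {morph f : x y / x * y} -> cancel f f' -> cancel f' f ->
  has_qi_type A B t <-> has_qi_type [set f x | x in A] [set f x | x in B] t.
Proof.
move=> fM fK f'K; split; first exact: (has_qi_type_image fM fK).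
have f'M : {morph f' : x y / x * y}.
  by move=> x y; rewrite -{1}[x]f'K -{1}[y]f'K -fM fK.
by move/(has_qi_type_image f'M f'K); rewrite !image_cancel.
Qed.

Lemma has_qi_type_conj (G : groupType) (g : G) A B t :
  has_qi_type A B t <-> has_qi_type (conj_of g A) (conj_of g B) t.
Proof.
apply: (has_qi_type_iso (f := fun x => g * x * g^-1)
  (f' := fun x => g^-1 * x * g)).
- by move=> x y; rewrite !mulgA mulgVK.
- by move=> x; rewrite !mulgA mulVg mul1g mulgVK.
- by move=> x; rewrite !mulgA mulgV mul1g mulgK.
Qed.

Section LabelTransport.
Variables (K K' : group_complex) (f : gc_vertex K -> gc_vertex K').
Variables (F : gc_group K -> gc_group K') (F' : gc_group K' -> gc_group K).
Hypotheses (FM : {morph F : x y / x * y}) (FK : cancel F F') (F'K : cancel F' F).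
Hypothesis f_comb : combinatorial_map f.
Hypothesis label_image : forall s A B, gc_label s A B ->
  gc_label (f @` s)%fset [set F x | x in A] [set F x | x in B].
Hypothesis label_unique : forall (s : {fset gc_vertex K'}) A B A' B',
  gc_label s A B -> gc_label s A' B' -> (A' = A /\ B' = B) \/ (A' = B /\ B' = A).
Hypothesis label_indep : forall (s t : {fset gc_vertex K}) A B A1 B1,
  gc_label s A B -> gc_label t A1 B1 -> B1 `<=` A -> B1 `<=` B -> False.

Let image_le (X Y : set (gc_group K)) :
  [set F x | x in X] `<=` [set F x | x in Y] -> X `<=` Y.
Proof.
move=> XY x Xx; have [|y Yy /(can_inj FK) <- //] := XY (F x).
by exists x.
Qed.

Let image_inj (X Y : set (gc_group K)) :
  [set F x | x in X] = [set F x | x in Y] -> X = Y.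
Proof. by move=> XY; apply/seteqP; split; apply: image_le; rewrite XY. Qed.

Lemma free_factor_sub (G : groupType) (A B : set G) :
  free_factor A B -> A `<=` B.
Proof. by move=> [_ [C []]]. Qed.

(** Up to order, the groups of the image chain are the images under [F]. The order cannot change
    along the chain: a swap between steps i and i+1 would put one coordinate group of step i+1 into
    both coordinates of step i, against [label_indep]. Equalities are then reflected because [F] is
    injective. *)
Lemma transport_semi_morphism : semi_morphism f.
Proof.
split=> // n c _ A B A' B' [lab ff] [lab' ff'].
have cases i : i <= n -> (A' i = [set F x | x in A i] /\ B' i = [set F x | x in B i]) \/
    (A' i = [set F x | x in B i] /\ B' i = [set F x | x in A i]).
  by move=> lin; apply: label_unique (lab' i lin); apply/label_image/lab.
pose straight i := A' i = [set F x | x in A i] /\ B' i = [set F x | x in B i].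
pose swapped i := A' i = [set F x | x in B i] /\ B' i = [set F x | x in A i].
have straightS i : i < n -> straight i -> straight i.+1.
  move=> lin [EA EB]; have [//|[EA1 EB1]] := cases _ lin.
  have [/free_factor_sub A1A _] := ff' i lin.
  have [_ /free_factor_sub B1B] := ff i lin.
  rewrite EA EA1 in A1A.
  by case: (label_indep (lab i (ltnW lin)) (lab _ lin) (image_le A1A) B1B).
have swappedS i : i < n -> swapped i -> swapped i.+1.
  move=> lin [EA EB]; have [[EA1 EB1]|//] := cases _ lin.
  have [/free_factor_sub A1A _] := ff' i lin.
  have [/free_factor_sub A1A' _] := ff i lin.
  rewrite EA EA1 in A1A.
  case: (label_indep (gc_labelC (lab i (ltnW lin))) (gc_labelC (lab _ lin))
    (image_le A1A) A1A').
have [st0|sw0] := cases 0 (leq0n n); [left | right] => i lin.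
  have st j : j <= n -> straight j.
    by elim: j => // j IH ltj; apply: straightS => //; apply: IH; apply: ltnW.
  have [[EA EB] [EA1 EB1]] := (st _ (ltnW lin), st _ lin).
  by rewrite EA EB EA1 EB1; split=> /image_inj.
have sw j : j <= n -> swapped j.
  by elim: j => // j IH ltj; apply: swappedS => //; apply: IH; apply: ltnW.
have [[EA EB] [EA1 EB1]] := (sw _ (ltnW lin), sw _ lin).
by rewrite EA EB EA1 EB1; split=> /image_inj.
Qed.

Lemma transport_qi_types : preserves_qi_types f.
Proof.
move=> s _ A B A' B' /label_image lab lab' t.
have [[-> ->]|[-> ->]] := label_unique lab lab'.
  exact: has_qi_type_iso FM FK F'K.
by rewrite [X in _ <-> X]has_qi_typeC; exact: has_qi_type_iso FM FK F'K.
Qed.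
End LabelTransport.

(** * Inverses of semi-isomorphisms and their action on edges *)

Section SemiIsomorphism.
Implicit Types K : group_complex.

Lemma imfsetK K K' (f : gc_vertex K -> gc_vertex K') g (s : {fset gc_vertex K}) :
  cancel f g -> (g @` (f @` s))%fset = s.
Proof.
move=> fK; apply/fsetP => x; apply/imfsetP/idP => /= [[_ /imfsetP[y /= ys ->] ->]|xs].
  by rewrite fK.
by exists (f x); rewrite ?fK //; apply/imfsetP; exists x.
Qed.

Lemma semi_isomorphic_sym K K' : semi_isomorphic K K' -> semi_isomorphic K' K.
Proof.
move=> [f [g [fK gK fS gS fqi]]]; exists g, f; split=> // s sK' A B A' B' lab lab' t.
apply: iff_sym; apply: (fqi (g @` s)%fset) => //; last by rewrite imfsetK.
by have [] := proj1 gS _ sK'.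
Qed.

Lemma semi_iso_simplex2 K K' (f : gc_vertex K -> gc_vertex K') g :
  cancel f g -> cancel g f -> semi_morphism f -> semi_morphism g -> forall x y,
  gc_simplex [fset x; y]%fset <-> gc_simplex [fset f x; f y]%fset.
Proof.
move=> fK gK [fc _] [gc _]; have im2 K1 K2 (h : gc_vertex K1 -> gc_vertex K2) z t :
    (h @` [fset z; t])%fset = [fset h z; h t]%fset by rewrite imfset_fset2.
move=> x y; split=> [/fc[]|/gc[]]; first by rewrite im2.
by rewrite im2 !fK.
Qed.
End SemiIsomorphism.

(** * Star vertices of the two complexes *)

Section Cosets.
Variable L : sgraph.
Implicit Types (g h x : raag L) (C D : {set L}).

(** Single vertices are cells, so containment of the subcomplexes amounts to containment of the
    cosets. *)
Lemma X_sub_le g h C D :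
  X_sub g C `<=` X_sub h D <-> raag_sub D (h^-1 * g) /\ C \subset D.
Proof.
split=> [le|[Dhg /raag_sub_mono CD] c [Xc cg]]; last first.
  split=> // x /cg/lcosetP/CD Dx; apply/lcosetP.
  by have := raag_subM Dhg Dx; rewrite mulgA mulgK.
have {}le x : raag_sub C (g^-1 * x) -> raag_sub D (h^-1 * x).
  move=> Cx; have [|_ le1] := le [set x].
    split; first by apply: Or31; exists x.
    by move=> _ ->; apply/lcosetP.
  by apply/lcosetP; apply: le1.
have Dhg : raag_sub D (h^-1 * g) by apply: le; rewrite mulVg; apply: raag_sub1.
split=> //; apply: raag_sub_le => x Cx.
by rewrite -(raag_subMl _ Dhg) -mulgA; apply: le; rewrite mulKg.
Qed.

Lemma X_sub_eq g h C D :
  X_sub g C = X_sub h D -> C = D /\ raag_sub C (g^-1 * h).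
Proof.
move=> E; have [|_ CD] := proj1 (X_sub_le g h C D); first by rewrite E.
have [|gh DC] := proj1 (X_sub_le h g D C); first by rewrite E.
by split=> //; apply/eqP; rewrite finset.eqEsubset CD.
Qed.

Lemma RI_inter1 (x : RI_vertex L) : RI_inter [fset x]%fset = val x.
Proof.
apply/setP => a; apply/RI_interP/idP => [|ax C]; first by apply; rewrite inE.
by rewrite inE => /eqP ->.
Qed.

Lemma I_inter1 (x : I_vertex L) : I_inter [fset x]%fset = val x.
Proof.
apply/seteqP; split=> [c xc|c xc P]; first by apply: xc; rewrite inE.
by rewrite inE => /eqP ->.
Qed.
End Cosets.

Section StarVertices.
Variable L : sgraph.
Hypotheses (tri : triangle_free L) (undom : undominated L) (edge : has_edge L).
Implicit Types (g h : raag L) (v w : L).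

Lemma star_qi_type v : has_qi_type (raag_sub [set v]%SET) (raag_sub (lk v)) QI_ZF.
Proof.
left; split; first exact: raag_sub_cyclic.
have [a [b [va vb ab]]] := two_neighbours undom edge v.
apply: (raag_sub_nonabelian_free _ _ _ ab); rewrite ?finset.inE //.
exact: joined_edgeless tri _ _ (joinedC (joined_star undom edge v)).
Qed.

(** A cyclic factor is abelian, so any two vertices on its side commute; that side being edgeless,
    it is a single vertex, and maximality turns the join into the star of this vertex. *)
Lemma star_of_qi_type C D : joined C D -> max_join (C :|: D)%SET ->
  has_qi_type (raag_sub C) (raag_sub D) QI_ZF -> exists v, (C :|: D)%SET = star v.
Proof.
wlog cC : C D / infinite_cyclic (raag_sub C).
  move=> H CD maxCD qi; have [[cC _]|[_ cD]] := qi; first exact: H.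
  rewrite finset.setUC; apply: H => //; first exact: joinedC.
    by rewrite finset.setUC.
  exact/has_qi_typeC.
move=> CD maxCD _; have [[v vC] _ _] := joinedP _ _ CD; exists v.
have CE : C = [set v]%SET.
  apply/setP => a; rewrite finset.inE; apply/idP/eqP => [aC|->//].
  have := infinite_cyclic_abelian cC (raag_sub_gen aC) (raag_sub_gen vC).
  move/raag_gen_commute => [//|av].
  by have := joined_edgeless tri CD aC vC; rewrite av.
by rewrite CE in CD maxCD *; apply: max_join1 maxCD CD _.
Qed.

Definition RI_star v : RI_vertex L :=
  exist _ (star v) (max_join_star tri undom edge v).

Lemma RI_star_inj : injective RI_star.
Proof. by move=> v w /(congr1 val); apply: star_inj. Qed.

(** A common edge of two stars forces adjacency or equality by [edge_in_stars]. Conversely the edge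
    from [v] to [w] lies in both stars. For v = w the pair degenerates to one vertex, and any edge
    at [v] serves. *)
Lemma RI_star_simplex v w :
  RI_simplex [fset RI_star v; RI_star w]%fset <-> w \in star v.
Proof.
have interP x : reflect (x \in star v /\ x \in star w)
    (x \in RI_inter [fset RI_star v; RI_star w]%fset).
  apply: (iffP (RI_interP _ _)) => [H|[xv xw] C /fset2P[] -> //].
  by split; [apply: (H _ (fset21 _ _)) | apply: (H _ (fset22 _ _))].
split=> [[_ [x [y [/interP[xv xw] /interP[yv yw] xy]]]]|wv].
  exact: edge_in_stars xy.
split; first by apply/fset0Pn; exists (RI_star v); apply: fset21.
have [vw|vw] := eqVneq w v.
  have [a [_ [va _ _]]] := two_neighbours undom edge v.
  have av : a \in star v by rewrite in_star va orbT.
  have vv := mem_star v.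
  by exists v, a; split=> //; apply/interP; rewrite vw.
move: (wv); rewrite in_star (negPf vw) /= => vwE.
have [vv ww] := (mem_star v, mem_star w).
by exists v, w; split=> //; apply/interP; split=> //; rewrite star_sym.
Qed.

Definition I_star g v : I_vertex L :=
  exist _ (X_sub g (star v)) (mem_set (ex_intro _ g (ex_intro _ (star v)
    (conj (max_join_star tri undom edge v) erefl)))).

Lemma I_star_eq g v h w : I_star g v = I_star h w ->
  v = w /\ raag_sub (star v) (g^-1 * h).
Proof. by move=> /(congr1 val) /X_sub_eq[/(star_inj undom)]. Qed.

Lemma I_star_coset g v h : raag_sub (star v) (g^-1 * h) -> I_star g v = I_star h v.
Proof.
move=> gh; apply: val_inj; apply/seteqP; split; apply/X_sub_le; split=> //.
by rewrite -raag_subVE invgM invgK.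
Qed.

Lemma I_star_simplex g v h w :
  I_simplex [fset I_star g v; I_star h w]%fset <-> near g v h w.
Proof.
split=> [[_ [P [k [E [/is_joinP[A [B [AB EE]]] PE]]] Ple]]|[wv [q [gq hq]]]].
  have leE z u : (I_star z u) \in [fset I_star g v; I_star h w]%fset ->
      raag_sub (star u) (z^-1 * k) /\ E \subset star u.
    by move=> zu; apply/X_sub_le; rewrite -PE => c /Ple /(_ _ zu).
  have [gk /fintype.subsetP Ev] := leE g v (fset21 _ _).
  have [hk /fintype.subsetP Ew] := leE h w (fset22 _ _).
  split; last by exists k.
  have [[a aA] [b bB] ABE] := joinedP _ _ AB.
  have [aE bE] : a \in E /\ b \in E by rewrite EE !finset.in_setU aA bB orbT.
  by apply: (edge_in_stars tri (a := a) (b := b)); auto.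
split; first by apply/fset0Pn; exists (I_star g v); apply: fset21.
have [E [jE Ev Ew]] : exists E : {set L}, [/\ is_join E, E \subset star v & E \subset star w].
  move: (wv); rewrite in_star => /orP[/eqP ->|vw].
    by exists (star v); split=> //; apply: is_join_star.
  exists ([set v] :|: [set w])%SET; split.
  - apply/is_joinP; exists [set v]%SET, [set w]%SET; split=> //; apply/joinedP.
    split; [by exists v; rewrite finset.inE | by exists w; rewrite finset.inE|].
    by move=> a b; rewrite !finset.inE => /eqP -> /eqP ->.
  - by apply/fintype.subsetP => a; rewrite !finset.inE => /orP[] /eqP -> //;
      rewrite ?eqxx // vw orbT.
  - by apply/fintype.subsetP => a; rewrite !finset.inE => /orP[] /eqP -> //;
      rewrite ?eqxx // sedge_sym vw orbT.
exists (X_sub q E); first by exists q, E.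
move=> c qc P /fset2P[] -> /=.
- by have /X_sub_le H : raag_sub (star v) (g^-1 * q) /\ E \subset star v by []; apply: H.
- by have /X_sub_le H : raag_sub (star w) (h^-1 * q) /\ E \subset star w by []; apply: H.
Qed.

End StarVertices.

(** * Recovering the graph *)

Section Recover.
Variables L M : sgraph.
Hypotheses (triL : triangle_free L) (undomL : undominated L) (edgeL : has_edge L).
Hypotheses (triM : triangle_free M) (undomM : undominated M) (edgeM : has_edge M).

(** The vertex of a star carries a group of type [QI_ZF], which [f] preserves, and among maximal
    joins this type occurs only for stars. *)
Lemma RI_star_image (f : RI_vertex L -> RI_vertex M) :
  @preserves_qi_types (reduced_intersection_complex L)
    (reduced_intersection_complex M) f ->
  forall v, exists w, f (RI_star triL undomL edgeL v) = RI_star triM undomM edgeM w.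
Proof.
move=> fqi v; set x := RI_star _ _ _ v.
have maxfx := valP (f x); have [/is_joinP[C [D [CD fxE]]] _] := maxsetP maxfx.
have xlab : RI_label [fset x]%fset (raag_sub [set v]%SET) (raag_sub (lk v)).
  exists [set v]%SET, (lk v); split=> //; first exact: joined_star.
  by rewrite RI_inter1.
have fxlab : RI_label (f @` [fset x])%fset (raag_sub C) (raag_sub D).
  by exists C, D; rewrite imfset_fset1 RI_inter1.
have qi := proj1 (fqi _ (@RI_point L x) _ _ _ _ xlab fxlab QI_ZF)
  (star_qi_type triL undomL edgeL v).
rewrite fxE in maxfx; have [w wE] := star_of_qi_type triM undomM edgeM CD maxfx qi.
by exists w; apply: val_inj; rewrite fxE wE.
Qed.

Lemma RI_embedding : semi_isomorphic (reduced_intersection_complex L)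
  (reduced_intersection_complex M) -> exists f : L -> M, full_embedding f.
Proof.
move=> [f [g [fK gK fS gS fqi]]].
have [phi phiE] := choice (RI_star_image fqi); exists phi.
have phi_inj : injective phi.
  move=> v w vw; apply: (@RI_star_inj L triL undomL edgeL).
  by apply: (can_inj fK); rewrite !phiE vw.
split=> // v w; have := semi_iso_simplex2 fK gK fS gS (RI_star triL undomL edgeL v)
  (RI_star triL undomL edgeL w).
rewrite /= !phiE !RI_star_simplex !in_star (inj_eq phi_inj).
have [->|_] /= := eqVneq w v; first by rewrite !sedge_irr.
by move=> H; apply/idP/idP => /H.
Qed.

Lemma I_star_image (f : I_vertex L -> I_vertex M) :
  @preserves_qi_types (intersection_complex L) (intersection_complex M) f ->
  forall g v, exists h w,
    f (I_star triL undomL edgeL g v) = I_star triM undomM edgeM h w.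
Proof.
move=> fqi g v; set x := I_star _ _ _ g v.
have /set_mem[h [E [maxE fxE]]] := valP (f x).
have [/is_joinP[C [D [CD EE]]] _] := maxsetP maxE.
have xlab : I_label [fset x]%fset (conj_of g (raag_sub [set v]%SET))
    (conj_of g (raag_sub (lk v))).
  exists g, [set v]%SET, (lk v); split=> //; first exact: joined_star.
  by rewrite I_inter1.
have fxlab : I_label (f @` [fset x])%fset (conj_of h (raag_sub C))
    (conj_of h (raag_sub D)).
  by exists h, C, D; rewrite imfset_fset1 I_inter1 fxE EE.
have qi := proj1 (fqi _ (@I_point L x) _ _ _ _ xlab fxlab QI_ZF)
  (proj1 (has_qi_type_conj _ _ _ _) (star_qi_type triL undomL edgeL v)).
have {}qi := proj2 (has_qi_type_conj _ _ _ _) qi.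
rewrite EE in maxE; have [w wE] := star_of_qi_type triM undomM edgeM CD maxE qi.
by exists h, w; apply: val_inj; rewrite fxE EE wE.
Qed.
End Recover.

(** * From the intersection complex back to the graph *)

Section RecoverFromIntersectionComplex.
Variables L M : sgraph.
Hypotheses (triL : triangle_free L) (undomL : undominated L) (edgeL : has_edge L).
Hypotheses (triM : triangle_free M) (undomM : undominated M) (edgeM : has_edge M).
Hypothesis connL : star_connected L.

Notation starL := (I_star triL undomL edgeL).
Notation starM := (I_star triM undomM edgeM).

Variables (f : I_vertex L -> I_vertex M) (f' : I_vertex M -> I_vertex L).
Hypothesis f_near : forall g v h w k a l b,
  f (starL g v) = starM k a -> f (starL h w) = starM l b ->
  near g v h w <-> near k a l b.
Hypotheses (f'K : cancel f' f) (f_inj : injective f).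
Hypothesis f'_star : forall k a, exists g v, f' (starM k a) = starL g v.
Variables (h : L -> raag M) (phi : L -> M).
Hypothesis f_phi : forall v, f (starL 1 v) = starM (h v) (phi v).

Lemma near1 (v w : L) : near 1 v 1 w <-> w \in star v.
Proof.
split=> [[]//|wv]; split=> //; exists 1; rewrite invg1 mulg1.
by split; apply: raag_sub1.
Qed.

(* If two of the images were disjoint, a wall would separate them; but the wall
   corresponds to a vertex of the first complex whose star does not separate
   the vertices [starL 1 v]. *)
Lemma images_meet v w : meets (h v, star (phi v)) (h w, star (phi w)).
Proof.
apply: contrapT => disj.
have [|k [t [x [c [vx wx cross nv nw]]]]] :=
    @separation _ (h v) (phi v) (h w) (phi w).
  by move=> q vq wq; apply: disj; exists q.
have [g [a f'E]] := f'_star k t.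
have fE : f (starL g a) = starM k t by rewrite -f'E f'K.
pose S : {set L} := [set d | `[< near g a 1 d >]]%SET.
have farP u : u \notin S -> ~ near k t (h u) (phi u).
  move=> /negP uS kt; apply: uS; rewrite finset.inE; apply/asboolP.
  exact: (proj2 (f_near fE (f_phi u))).
have conn : connect (off S) v w.
  by apply: near_connected => //; [move=> nr; apply: nv | move=> nr; apply: nw];
     apply/(f_near fE (f_phi _)).
(* The image coset of [u] lies entirely on the side of [x]. This passes to an adjacent [u'] outside
   [S]: the two image cosets share a point [q], and a path within the second coset from [q] on does
   not cross the wall. *)
pose side u := forall y d, raag_sub (star (phi u)) ((h u)^-1 * y) ->
  x * elt d = y -> crossings t (wall k t) x d = false.
have sideS u u' : off S u u' -> side u -> side u'.
  move=> /and3P[uS u'S uu'] side_u y d u'y xdy.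
  have : near 1 u 1 u' by apply/near1; rewrite in_star uu' orbT.
  move/(f_near (f_phi u) (f_phi u')) => [_ [q [uq u'q]]].
  have [d1 d1E] := elt_surj (x^-1 * q); have [d2 d2E] := elt_surj (q^-1 * y).
  have -> : crossings t (wall k t) x d = crossings t (wall k t) x (d1 ++ d2).
    apply: crossings_elt; first exact: wall_lk.
    by rewrite elt_cat d1E d2E -xdy !mulgA mulgK mulVg mul1g.
  rewrite crossings_cat (side_u q) //; last by rewrite d1E mulVKg.
  rewrite d1E mulVKg; apply: (uncrossed (farP _ u'S) u'q u'y).
  by rewrite d2E mulVKg.
have side_v : side v by move=> y d vy xdy; apply: uncrossed nv vx vy xdy.
suff /(_ _ _ wx erefl) : side w by rewrite cross.
have [p + ->] := connectP conn.
elim: p (v) side_v => //= b p IH u side_u /andP[ub]; apply: IH.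
exact: sideS ub side_u.
Qed.

(** All image cosets share a point [q] by [helly]. Nearness of two of them then reduces to
    [phi w \in star (phi v)], and phi v = phi w makes the cosets themselves equal, so injectivity of
    [f] applies. *)
Lemma phi_embedding : full_embedding phi.
Proof.
have [|q Hq] := @helly M [seq (h v, star (phi v)) | v <- enum L].
  by move=> _ _ /mapP[v _ ->] /mapP[w _ ->]; apply: images_meet.
have {}Hq v : raag_sub (star (phi v)) ((h v)^-1 * q).
  by apply: (Hq (_, _)); apply: map_f; rewrite mem_enum.
have phi_inj : injective phi.
  move=> v w vw; suff /f_inj/I_star_eq[] : f (starL 1 v) = f (starL 1 w) by [].
  rewrite !f_phi (I_star_coset triM undomM edgeM (Hq v)).
  by rewrite (I_star_coset triM undomM edgeM (Hq w)) vw.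
split=> // v w; have := f_near (f_phi v) (f_phi w).
have -> : near (h v) (phi v) (h w) (phi w) <-> phi w \in star (phi v).
  by split=> [[]//|]; split=> //; exists q.
rewrite near1 !in_star (inj_eq phi_inj).
have [->|_] /= := eqVneq w v; first by rewrite !sedge_irr.
by move=> H; apply/idP/idP => /H.
Qed.
End RecoverFromIntersectionComplex.

Lemma I_embedding (L M : sgraph) :
  triangle_free L -> undominated L -> has_edge L -> star_connected L ->
  triangle_free M -> undominated M -> has_edge M ->
  semi_isomorphic (intersection_complex L) (intersection_complex M) ->
  exists f : L -> M, full_embedding f.
Proof.
move=> triL undomL edgeL connL triM undomM edgeM iso.
have [f [g [fK gK fS gS fqi]]] := iso.
have gqi : preserves_qi_types g.
  move=> s sK' A B A' B' lab lab' t; apply: iff_sym.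
  apply: (fqi (g @` s)%fset) => //; last by rewrite imfsetK.
  by have [] := proj1 gS _ sK'.
have H v := I_star_image triL undomL edgeL triM undomM edgeM fqi 1 v.
have [h /choice[phi phiE]] := choice H; exists phi.
apply: (@phi_embedding L M triL undomL edgeL triM undomM edgeM connL f g _ gK
  (can_inj fK) _ h phi phiE) => [x v y w k a l b E1 E2|]; last exact: I_star_image.
have := semi_iso_simplex2 fK gK fS gS (I_star triL undomL edgeL x v)
  (I_star triL undomL edgeL y w).
by rewrite E1 E2 /= !I_star_simplex.
Qed.

(** * Uniqueness of the assigned groups and independence of their coordinates *)

Section LabelProperties.
Variable L : sgraph.
Hypothesis tri : triangle_free L.
Implicit Types (g : raag L) (C D : {set L}).

Lemma RI_label_unique (s : {fset RI_vertex L}) A B A' B' :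
  RI_label s A B -> RI_label s A' B' -> (A' = A /\ B' = B) \/ (A' = B /\ B' = A).
Proof.
move=> [C [D [CD sE -> ->]]] [C' [D' [CD' sE' -> ->]]].
by have [[-> ->]|[-> ->]] := joined_unique tri CD CD' (etrans (esym sE) sE'); auto.
Qed.

Lemma RI_label_indep (s t : {fset RI_vertex L}) A B A1 B1 :
  RI_label s A B -> RI_label t A1 B1 -> B1 `<=` A -> B1 `<=` B -> False.
Proof.
move=> [C [D [CD _ -> ->]]] [C1 [D1 [/joinedP[_ [d dD1] _] _ _ ->]]] le1 le2.
by apply: (joined_disjoint CD (a := d)); apply/raag_sub_genE;
  [apply: le1 | apply: le2]; apply: raag_sub_gen.
Qed.

(** Write x = c d with [c] in A(C) and [d] in A(D): [c] normalises A(C) and [d] centralises it.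
    Hence the assigned group does not depend on the representative [g] of the coset. *)
Lemma joined_conj C D g x : joined C D -> raag_sub (C :|: D)%SET x ->
  conj_of (g * x) (raag_sub C) = conj_of g (raag_sub C).
Proof.
move=> CD; have [_ _ CDE] := joinedP _ _ CD.
have le z y : raag_sub (C :|: D)%SET y ->
    conj_of (z * y) (raag_sub C) `<=` conj_of z (raag_sub C).
  move=> /(raag_sub_join CDE)[c [d [Cc Dd ->]]] _ [e Ce <-].
  exists (c * e * c^-1); first by apply: raag_subM; [apply: raag_subM | apply: raag_subV].
  have de := raag_sub_comm CDE Ce Dd.
  by rewrite !invgM !mulgA -(mulgA _ d e) -de mulgA mulgK.
move=> xCD; apply/seteqP; split; first exact: le.
by rewrite -{1}(mulgK x g); apply: le; apply: raag_subV.
Qed.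

Lemma I_label_unique (s : {fset I_vertex L}) A B A' B' :
  I_label s A B -> I_label s A' B' -> (A' = A /\ B' = B) \/ (A' = B /\ B' = A).
Proof.
move=> [g [C [D [CD sE -> ->]]]] [g' [C' [D' [CD' sE' -> ->]]]].
have [CDE gg'] := X_sub_eq (etrans (esym sE) sE').
have DC := joinedC CD; have DCE := finset.setUC C D.
have Cg : conj_of g' (raag_sub C) = conj_of g (raag_sub C).
  by rewrite -(mulVKg g g'); apply: joined_conj CD _.
have Dg : conj_of g' (raag_sub D) = conj_of g (raag_sub D).
  by rewrite -(mulVKg g g'); apply: joined_conj DC _; rewrite -DCE.
by have [[-> ->]|[-> ->]] := joined_unique tri CD CD' CDE; rewrite Cg Dg; auto.
Qed.

(** [B1] contains a conjugate of a generator, which is nontrivial, whereas [A] and [B] are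
    conjugates by one element of A(C) and A(D), which meet trivially because [C] and [D] are
    disjoint. *)
Lemma I_label_indep (s t : {fset I_vertex L}) A B A1 B1 :
  I_label s A B -> I_label t A1 B1 -> B1 `<=` A -> B1 `<=` B -> False.
Proof.
move=> [g [C [D [CD _ -> ->]]]] [k [C1 [D1 [/joinedP[_ [d dD1] _] _ _ ->]]]] le1 le2.
have kd : conj_of k (raag_sub D1) (k * raag_gen d * k^-1).
  by exists (raag_gen d) => //; apply: raag_sub_gen.
have [x Cx xE] := le1 _ kd; have [y Dy yE] := le2 _ kd.
have xy : x = y by apply: (mulgI g); apply: (mulIg g^-1); rewrite xE yE.
have x1 : x = 1.
  apply: raag_sub0; have : raag_sub (C :&: D)%SET x by apply: raag_subI => //; rewrite xy.
  apply: raag_sub_mono; apply/fintype.subsetP => a; rewrite finset.in_setI.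
  by case/andP=> aC aD; case: (joined_disjoint CD aC aD).
apply: (@raag_gen_neq1 _ d); apply: (mulgI k); apply: (mulIg k^-1).
by rewrite -xE x1 !mulg1 !mulgV.
Qed.
End LabelProperties.

(** * Complexes of isomorphic graphs *)

Section GraphMap.
Variables (L M : sgraph) (phi : L -> M).
Hypothesis phiE : forall x y, sedge (phi x) (phi y) = sedge x y.
Implicit Types (g x y : raag L) (C D : {set L}).

Definition raag_map : raag L -> raag M := lift (fun a => raag_gen (phi a)).

Let raag_map_comm a b : sedge a b ->
  raag_gen (phi a) * raag_gen (phi b) = raag_gen (phi b) * raag_gen (phi a).
Proof. by move=> ab; apply: raag_gen_comm; rewrite phiE. Qed.

Lemma raag_mapM : {morph raag_map : x y / x * y}.
Proof. exact: liftM raag_map_comm. Qed.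

Lemma raag_map_gen a : raag_map (raag_gen a) = raag_gen (phi a).
Proof. exact: lift_gen raag_map_comm _. Qed.

Lemma raag_map_sub C :
  [set raag_map x | x in raag_sub C] = raag_sub (phi @: C)%SET.
Proof.
rewrite /raag_sub (generated_image raag_mapM); congr generated.
apply/seteqP; split=> [_ [_ [a aC <-] <-]|_ [_ /= /imsetP[a aC ->] <-]].
  by exists (phi a); rewrite ?raag_map_gen //=; apply: imset_f.
by exists (raag_gen a); [exists a | rewrite raag_map_gen].
Qed.

Lemma X_cell_map c : X_cell c -> X_cell [set raag_map x | x in c].
Proof.
case=> [[g ->]|[g [a ->]]|[g [a [b [ab ->]]]]].
- by apply: Or31; exists (raag_map g); rewrite image_set1.
- apply: Or32; exists (raag_map g), (phi a).
  by rewrite image_setU !image_set1 raag_mapM raag_map_gen.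
- apply: Or33; exists (raag_map g), (phi a), (phi b); rewrite phiE.
  by rewrite !image_setU !image_set1 !raag_mapM !raag_map_gen.
Qed.

Lemma joined_map C D : joined C D -> joined (phi @: C)%SET (phi @: D)%SET.
Proof.
move=> /joinedP[[c cC] [d dD] CD]; apply/joinedP; split.
- by exists (phi c); apply: imset_f.
- by exists (phi d); apply: imset_f.
- by move=> _ _ /imsetP[a aC ->] /imsetP[b bD ->]; rewrite phiE CD.
Qed.

Lemma is_join_map C : is_join C -> is_join (phi @: C)%SET.
Proof.
move=> /is_joinP[A [B [AB ->]]]; apply/is_joinP.
by exists (phi @: A)%SET, (phi @: B)%SET; rewrite imsetU; split=> //; apply: joined_map.
Qed.

Lemma conj_of_map g A : [set raag_map x | x in conj_of g A] =
  conj_of (raag_map g) [set raag_map x | x in A].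
Proof.
apply/seteqP; split=> [_ [_ [x Ax <-] <-]|_ [_ [x Ax <-] <-]].
  by exists (raag_map x); [exists x | rewrite !raag_mapM (morphV raag_mapM)].
by exists (g * x * g^-1); [exists x | rewrite !raag_mapM (morphV raag_mapM)].
Qed.
End GraphMap.

Lemma raag_mapK (L M : sgraph) (phi : L -> M) (psi : M -> L) :
  (forall x y, sedge (phi x) (phi y) = sedge x y) ->
  (forall x y, sedge (psi x) (psi y) = sedge x y) ->
  cancel phi psi -> cancel (raag_map phi) (raag_map psi).
Proof.
move=> phiE psiE phiK.
apply: (morph_eq (f := raag_map psi \o raag_map phi) (h := id)) => //.
  by move=> x y /=; rewrite !raag_mapM.
by move=> a /=; rewrite !raag_map_gen // phiK.
Qed.

Section GraphIso.
Variables (L M : sgraph) (phi : L -> M) (psi : M -> L).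
Hypotheses (phiE : forall x y, sedge (phi x) (phi y) = sedge x y)
  (psiE : forall x y, sedge (psi x) (psi y) = sedge x y)
  (phiK : cancel phi psi) (psiK : cancel psi phi).
Implicit Types (C D : {set L}).

Lemma mem_phi C a : (a \in (phi @: C)%SET) = (psi a \in C).
Proof.
apply/imsetP/idP => [[x xC ->]|aC]; first by rewrite phiK.
by exists (psi a).
Qed.

Lemma max_join_map C : max_join C -> max_join (phi @: C)%SET.
Proof.
move=> /maxsetP[jC maxC]; apply/maxsetP; split; first exact: is_join_map.
move=> B jB CB; have : (psi @: B)%SET = C.
  apply: maxC; first exact: is_join_map.
  apply/fintype.subsetP => a aC; apply/imsetP; exists (phi a) => //.
  by apply: (fintype.subsetP CB); apply: imset_f.
move=> <-; apply/setP => b; rewrite mem_phi.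
by apply/idP/imsetP => [bB|[x xB /(can_inj psiK) -> //]]; exists b.
Qed.

Definition RI_map (x : RI_vertex L) : RI_vertex M :=
  exist _ (phi @: val x)%SET (max_join_map (valP x)).

Lemma RI_inter_map s : RI_inter (RI_map @` s)%fset = (phi @: RI_inter s)%SET.
Proof.
apply/setP => a; rewrite mem_phi; apply/RI_interP/RI_interP => H C.
  move=> Cs; have := H (RI_map C); rewrite mem_phi; apply.
  by apply/imfsetP; exists C.
by move=> /imfsetP[x /= xs ->]; rewrite mem_phi; apply: H.
Qed.

Lemma RI_map_comb : @combinatorial_map (reduced_intersection_complex L)
  (reduced_intersection_complex M) RI_map.
Proof.
move=> s [/fset0Pn[z zs] [x [y [xs ys xy]]]]; split; last first.
  move=> C D _ _ /(congr1 val) /= CD; apply: val_inj; apply/setP => a.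
  by rewrite -[a]phiK -!mem_phi CD.
split; first by apply/fset0Pn; exists (RI_map z); apply/imfsetP; exists z.
exists (phi x), (phi y); rewrite phiE; split=> //;
  by rewrite RI_inter_map mem_phi phiK.
Qed.

Lemma RI_label_map s A B : RI_label s A B ->
  RI_label (RI_map @` s)%fset [set raag_map phi x | x in A] [set raag_map phi x | x in B].
Proof.
move=> [C [D [CD sE -> ->]]]; exists (phi @: C)%SET, (phi @: D)%SET.
rewrite !raag_map_sub // RI_inter_map sE imsetU; split=> //.
exact: joined_map.
Qed.

Let F := raag_map phi.
Let F' := raag_map psi.
Let FM : {morph F : x y / x * y} := raag_mapM phiE.
Let FK : cancel F F' := raag_mapK phiE psiE phiK.
Let F'K : cancel F' F := raag_mapK psiE phiE psiK.

Let F_sub C x : raag_sub (phi @: C)%SET (F x) <-> raag_sub C x.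
Proof.
rewrite -(raag_map_sub phiE); split=> [[y Cy /(can_inj FK) <-//]|Cx].
by exists x.
Qed.

Lemma X_sub_map g C c :
  X_sub g C [set F' x | x in c] <-> X_sub (F g) (phi @: C)%SET c.
Proof.
have cosetE x : raag_sub C (g^-1 * F' x) <->
    raag_sub (phi @: C)%SET ((F g)^-1 * x).
  by rewrite -F_sub FM (morphV FM) F'K.
split=> [[Xc cg]|[Xc cg]]; split.
- by rewrite -(image_cancel c F'K); apply: X_cell_map.
- by move=> x cx; apply/lcosetP/cosetE/lcosetP/cg; exists x.
- exact: X_cell_map.
- by move=> _ [x cx <-]; apply/lcosetP/cosetE/lcosetP/cg.
Qed.

Lemma X_sub_mapE g C :
  [set c | X_sub g C [set F' x | x in c]] = X_sub (F g) (phi @: C)%SET.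
Proof. by apply/seteqP; split=> c /X_sub_map. Qed.

Lemma max_product_map P : max_product_subcomplex P ->
  max_product_subcomplex [set c | P [set F' x | x in c]].
Proof.
move=> [g [C [maxC ->]]]; exists (F g), (phi @: C)%SET.
by split; [exact: max_join_map | exact: X_sub_mapE].
Qed.

(** The image subcomplex is described by pulling cells back along the inverse isomorphism [F']. *)
Definition I_map (P : I_vertex L) : I_vertex M :=
  exist _ [set c | val P [set F' x | x in c]]
    (mem_set (max_product_map (set_mem (valP P)))).

Lemma I_inter_map s c :
  I_inter (I_map @` s)%fset c <-> I_inter s [set F' x | x in c].
Proof.
split=> H P.
  by move=> Ps; apply: (H (I_map P)); apply/imfsetP; exists P.
by move=> /imfsetP[Q /= Qs ->]; apply: H.
Qed.

Lemma I_map_inj : injective I_map.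
Proof.
move=> P Q /(congr1 val) /= PQ; apply: val_inj.
(* Writing [c] as the image under [F'] of its image under [F] turns membership in [P] or [Q] into
   membership in [I_map P] or [I_map Q]. *)
apply/seteqP; split=> c; rewrite -(image_cancel c FK).
  by rewrite -[X in X -> _]/([set c | val P [set F' x | x in c]] _) PQ.
by rewrite -[X in X -> _]/([set c | val Q [set F' x | x in c]] _) -PQ.
Qed.

Lemma I_map_comb : @combinatorial_map (intersection_complex L)
  (intersection_complex M) I_map.
Proof.
move=> s [/fset0Pn[z zs] [_ [g [E [jE ->]]] Es]]; split; last first.
  by move=> P Q _ _; apply: I_map_inj.
split; first by apply/fset0Pn; exists (I_map z); apply/imfsetP; exists z.
exists (X_sub (F g) (phi @: E)%SET).
  by exists (F g), (phi @: E)%SET; split=> //; apply: is_join_map.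
by move=> c /X_sub_map/Es/I_inter_map.
Qed.

Lemma I_label_map s A B : I_label s A B ->
  I_label (I_map @` s)%fset [set F x | x in A] [set F x | x in B].
Proof.
move=> [g [C [D [CD sE -> ->]]]]; exists (F g), (phi @: C)%SET, (phi @: D)%SET.
rewrite -imsetU -!(raag_map_sub phiE) -!(conj_of_map phiE); split=> //.
  exact: joined_map.
rewrite -X_sub_mapE -sE; apply/seteqP.
by split=> c /I_inter_map.
Qed.

End GraphIso.

Lemma isometric_semi_isomorphic (L M : sgraph) :
  triangle_free L -> triangle_free M -> isometric L M ->
  semi_isomorphic (reduced_intersection_complex L) (reduced_intersection_complex M) /\
  semi_isomorphic (intersection_complex L) (intersection_complex M).
Proof.
move=> triL triM [phi [psi phiK psiK] phiE].
have psiE x y : sedge (psi x) (psi y) = sedge x y by rewrite -phiE !psiK.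
have FK := raag_mapK phiE psiE phiK; have F'K := raag_mapK psiE phiE psiK.
split.
  exists (RI_map phiE psiE phiK psiK), (RI_map psiE phiE psiK phiK); split.
  - move=> x; apply: val_inj; apply/setP => a.
    by rewrite (mem_phi psiK phiK) (mem_phi phiK psiK) phiK.
  - move=> x; apply: val_inj; apply/setP => a.
    by rewrite (mem_phi phiK psiK) (mem_phi psiK phiK) psiK.
  - apply: (@transport_semi_morphism (reduced_intersection_complex L) (reduced_intersection_complex M) _ _ _ FK
      (RI_map_comb phiE psiE phiK psiK)).
    + exact: RI_label_map.
    + exact: RI_label_unique.
    + exact: RI_label_indep.
  - apply: (@transport_semi_morphism (reduced_intersection_complex M) (reduced_intersection_complex L) _ _ _ F'K
      (RI_map_comb psiE phiE psiK phiK)).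
    + exact: RI_label_map.
    + exact: RI_label_unique.
    + exact: RI_label_indep.
  - apply: (@transport_qi_types (reduced_intersection_complex L)
      (reduced_intersection_complex M) _ _ _ (raag_mapM phiE) FK F'K).
    + exact: RI_label_map.
    + exact: RI_label_unique.
exists (I_map phiE psiE phiK psiK), (I_map psiE phiE psiK phiK); split.
- by move=> P; apply: val_inj; apply/seteqP; split=> c /=; rewrite image_cancel.
- by move=> P; apply: val_inj; apply/seteqP; split=> c /=; rewrite image_cancel.
- apply: (@transport_semi_morphism (intersection_complex L) (intersection_complex M) _ _ _ FK
      (I_map_comb phiE psiE phiK psiK)).
  + exact: I_label_map.
  + exact: I_label_unique.
  + exact: I_label_indep.
- apply: (@transport_semi_morphism (intersection_complex M) (intersection_complex L) _ _ _ F'K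
      (I_map_comb psiE phiE psiK phiK)).
  + exact: I_label_map.
  + exact: I_label_unique.
  + exact: I_label_indep.
- apply: (@transport_qi_types (intersection_complex L)
      (intersection_complex M) _ _ _ (raag_mapM phiE) FK F'K).
  + exact: I_label_map.
  + exact: I_label_unique.
Qed.

Theorem theorem5p6 (L M : sgraph) :
  connected_graph L -> triangle_free L -> has_edge L ->
  connected_graph M -> triangle_free M -> has_edge M ->
  finite_set (Out (raag L)) -> finite_set (Out (raag M)) ->
  (isometric L M <->
   semi_isomorphic (reduced_intersection_complex L)
                   (reduced_intersection_complex M)) /\
  (semi_isomorphic (reduced_intersection_complex L)
                   (reduced_intersection_complex M) <->
   semi_isomorphic (intersection_complex L) (intersection_complex M)).
Proof.
move=> _ triL edgeL _ triM edgeM finL finM.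
have [undomL undomM] := (finite_Out_undominated finL, finite_Out_undominated finM).
have connL := finite_Out_star_connected finL.
have connM := finite_Out_star_connected finM.
have ab := isometric_semi_isomorphic triL triM.
have ba : semi_isomorphic (reduced_intersection_complex L)
    (reduced_intersection_complex M) -> isometric L M.
  move=> iso; have [f fE] := RI_embedding triL undomL edgeL triM undomM edgeM iso.
  have [g gE] := RI_embedding triM undomM edgeM triL undomL edgeL
    (semi_isomorphic_sym iso).
  exact: isometric_of_embeddings fE gE.
have ca : semi_isomorphic (intersection_complex L) (intersection_complex M) ->
    isometric L M.
  move=> iso.
  have [f fE] := I_embedding triL undomL edgeL connL triM undomM edgeM iso.
  have [g gE] := I_embedding triM undomM edgeM connM triL undomL edgeL
    (semi_isomorphic_sym iso).
  exact: isometric_of_embeddings fE gE.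
split; split=> [iso|iso]; first by case: (ab iso).
- exact: ba.
- by case: (ab (ba iso)).
- by case: (ab (ca iso)).
Qed.
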